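(* Let $d\ge 2$ and let $\Phi$ be a linear graph directed Markov system associated to the free group $F_d=\langle g_1,\dots,g_d\rangle$. For every normal subgroup $N$ of $F_d$ we have $$\delta(N,\Phi)=\dim_H\left(\Lambda_{ur}(N,\Phi)\right)=\dim_H\left(\Lambda_{r}(N,\Phi)\right),$$ where $\dim_H$ denotes Hausdorff dimension.
   Context: Let $d\ge2$ and let $F_d=\langle g_1,\dots,g_d\rangle$ be the free group on $g_1,\dots,g_d$. Put $V:=\{g_1,g_1^{-1},\dots,g_d,g_d^{-1}\}$ and $E:=\{(v,w)\in V^2: v\ne w^{-1}\}$. A linear graph directed Markov system (linear GDMS) $\Phi$ associated to $F_d$ consists of nonempty compact sets $X_v\subset\mathbb{R}^D$ ($v\in V$), for some $D\ge1$, and of maps $\phi_{(v,w)}:X_w\to X_v$ ($(v,w)\in E$), each of which is the restriction of a similarity of $\mathbb{R}^D$ with contraction ratio in $(0,1)$, such that: (i) each $X_v$ is connected and equal to the closure of its interior; (ii) (open set condition) for all distinct edges $(v,w)\neq(v',w')$ in $E$, $\phi_{(v,w)}(\mathrm{Int}(X_w))\cap\phi_{(v',w')}(\mathrm{Int}(X_{w'}))=\emptyset$; (iii) (cone property) there exist $l>0$ and $0<\gamma<\pi/2$ such that for each $v\in V$ and $x\in X_v$ there is an open cone with vertex $x$, central angle of measure $\gamma$ and altitude $l$ contained in $\mathrm{Int}(X_v)$; (iv) the contraction ratio of $\phi_{(v,w)}$ is independent of $w$; it is denoted $c_\Phi(v)$. (The remaining conditions in the definition of a conformal GDMS hold automatically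 for similarities.) Extend $c_\Phi$ to $F_d$ by $c_\Phi(g):=\prod_{i=1}^n c_\Phi(v_i)$, where $v_1\cdots v_n$ is the unique representation of $g$ as a reduced word in elements of $V$ (with $c_\Phi(\mathrm{id})=1$). For a subgroup $H$ of $F_d$ set $\delta(H,\Phi):=\inf\{t\ge0:\sum_{h\in H}c_\Phi(h)^t<\infty\}$. Let $\Sigma_\Phi$ be the set of sequences $((v_i,w_i))_{i\ge1}\in E^{\mathbb{N}}$ with $w_i=v_{i+1}$ for all $i\ge 1$. The coding map $\pi_\Phi:\Sigma_\Phi\to\bigoplus_{v\in V}X_v$ (disjoint union) is defined by $\{\pi_\Phi(\omega)\}=\bigcap_{n\ge1}\phi_{\omega_1}\circ\cdots\circ\phi_{\omega_n}(X_{w_n})$ for $\omega=((v_i,w_i))_{i\ge 1}$, $\omega_i=(v_i,w_i)$. For a subgroup $H$ of $F_d$, the radial and uniformly radial limit sets of $H$ with respect to $\Phi$ are $$\Lambda_r(H,\Phi):=\pi_\Phi\{((v_i,w_i))\in\Sigma_\Phi:\exists\gamma\in F_d \text{ such that } v_1\cdots v_n\in H\gamma\text{ for infinitely many }n\in\mathbb{N}\},$$ $$\Lambda_{ur}(H,\Phi):=\pi_\Phi\{((v_i,w_i))\in\Sigma_\Phi:\exists\Gamma\subset F_d \text{ finite such that } v_1\cdots v_n\in H\Gamma\text{ for all }n\in\mathbb{N}\}.$$ Convention: $\dim_H(\emptyset)=0$. *)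

(* Defs.v *)
From HB Require Import structures.
From mathcomp Require Import all_boot all_order all_algebra.
From mathcomp Require Import all_classical all_reals all_analysis.

Set Implicit Arguments.
Unset Strict Implicit.
Unset Printing Implicit Defensive.

Import Order.TTheory GRing.Theory Num.Theory.
Import numFieldNormedType.Exports.

Local Open Scope classical_set_scope.
Local Open Scope ring_scope.

(* V = {g_1, g_1^-1, ..., g_d, g_d^-1}: the pair (i, false) stands for g_i and (i, true) for g_i^-1. *)
Definition letter (d : nat) : Type := ('I_d * bool)%type.

HB.instance Definition _ d := Finite.on (letter d).

Definition inv_letter d (v : letter d) : letter d := (v.1, ~~ v.2).

Definition edge d : rel (letter d) := fun v w => v != inv_letter w.

(* The free group F_d, realized as the set of reduced words; the product of
   two reduced words is the reduction of their concatenation. *)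
Record free_group (d : nat) := FreeGroup {
  word :> seq (letter d);
  word_reduced : sorted (@edge d) word }.

HB.instance Definition _ d := [isSub for @word d].
HB.instance Definition _ d := [Choice of free_group d by <:].

Section FreeGroupTheory.
Variable d : nat.
Implicit Types (v w : letter d) (s t u : seq (letter d)).
Local Notation reduced := (sorted (@edge d)).

Lemma inv_letterK : involutive (@inv_letter d).
Proof. by case=> i b; rewrite /inv_letter /= negbK. Qed.

Definition push v s :=
  if s is w :: s' then if edge v w then v :: s else s' else [:: v].

Definition mul_word s t := foldr push t s.

Lemma push_reduced v s : reduced s -> reduced (push v s).
Proof.
case: s => //= w s ps; case: ifP => [/= -> //|_].
exact: path_sorted ps.
Qed.

Lemma pushK v s : reduced s -> push (inv_letter v) (push v s) = s.
Proof.
case: s => [|w s] /=; first by rewrite /edge eqxx.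
move=> ps; case: ifP => [_|/negbFE/eqP ->]; first by rewrite /= /edge eqxx.
rewrite inv_letterK; case: s ps => [//|x s] /= /andP[-> _].
by [].
Qed.

Lemma mul_word_reduced s t : reduced t -> reduced (mul_word s t).
Proof. by move=> rt; elim: s => //= v s IH; exact: push_reduced. Qed.

Lemma mul_word_push v s t : reduced s -> reduced t ->
  mul_word (push v s) t = push v (mul_word s t).
Proof.
case: s => [//|w s] /= _ rt; case: ifP => [//|/negbFE/eqP ->].
by rewrite pushK //; exact: mul_word_reduced.
Qed.

Lemma mul_wordA s t u : reduced t -> reduced u ->
  mul_word s (mul_word t u) = mul_word (mul_word s t) u.
Proof.
move=> rt ru; elim: s => //= v s ->.
by rewrite mul_word_push //; exact: mul_word_reduced.
Qed.

Lemma mul_words0 s : reduced s -> mul_word s [::] = s.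
Proof.
elim: s => //= v s IH ps; rewrite IH ?(path_sorted ps) //.
by case: s ps {IH} => //= w s /andP[-> _].
Qed.

Definition inv_word s := rev (map (@inv_letter d) s).

Lemma inv_wordK : involutive inv_word.
Proof.
move=> s; rewrite /inv_word map_rev revK -map_comp.
by apply: map_id_in => v _; exact: inv_letterK.
Qed.

Lemma inv_word_reduced s : reduced s -> reduced (inv_word s).
Proof.
rewrite /inv_word rev_sorted sorted_map; apply: sub_sorted => v w.
rewrite /edge /= inv_letterK; by apply: contra => /eqP <-.
Qed.

Lemma mul_inv_word s : reduced s -> mul_word (inv_word s) s = [::].
Proof.
rewrite /inv_word /mul_word; elim: s => //= v s IH ps.
rewrite rev_cons foldr_rcons /= /edge eqxx /=.
exact: IH (path_sorted ps).
Qed.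

Definition fg_one : free_group d := @FreeGroup d [::] isT.
Definition fg_mul (x y : free_group d) : free_group d :=
  FreeGroup (mul_word_reduced x (word_reduced y)).
Definition fg_inv (x : free_group d) : free_group d :=
  FreeGroup (inv_word_reduced (word_reduced x)).

Lemma fg_mulA : associative fg_mul.
Proof. by move=> x y z; apply: val_inj; apply: mul_wordA; exact: word_reduced. Qed.

Lemma fg_mul1 : left_id fg_one fg_mul.
Proof. by move=> x; exact: val_inj. Qed.

Lemma fg_mulr1 : right_id fg_one fg_mul.
Proof. by move=> x; apply: val_inj; apply: mul_words0; exact: word_reduced. Qed.

Lemma fg_mulV : left_inverse fg_one fg_inv fg_mul.
Proof. by move=> x; apply: val_inj; apply: mul_inv_word; exact: word_reduced. Qed.

Lemma fg_mulrV : right_inverse fg_one fg_inv fg_mul.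
Proof.
move=> x; rewrite -[X in fg_mul X _](_ : fg_inv (fg_inv x) = x) ?fg_mulV //.
by apply: val_inj; exact: inv_wordK.
Qed.

End FreeGroupTheory.

HB.instance Definition _ d := isGroup.Build (free_group d)
  (@fg_mulA d) (@fg_mul1 d) (@fg_mulr1 d) (@fg_mulV d) (@fg_mulrV d).

Definition of_letter d (v : letter d) : free_group d := @FreeGroup d [:: v] isT.

Lemma of_letterV d (v : letter d) :
  of_letter (inv_letter v) = ((of_letter v)^-1)%g.
Proof. exact: val_inj. Qed.

Lemma prod_of_letter d (x : free_group d) :
  (\prod_(v <- word x) of_letter v)%g = x.
Proof.
case: x => s /= rs; apply: val_inj => /=.
elim: s rs => [|v s IH] /= rs; first by rewrite big_nil.
rewrite big_cons /= IH ?(path_sorted rs) //.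
by case: s rs {IH} => //= w s /andP[-> _].
Qed.

Definition subgroup d (H : set (free_group d)) : Prop :=
  [/\ H 1%g, forall x y, H x -> H y -> H (x * y)%g
    & forall x, H x -> H (x^-1)%g].

Definition normal_subgroup d (N : set (free_group d)) : Prop :=
  subgroup N /\ forall x g, N x -> N (g^-1 * x * g)%g.

(* The library norm on 'rV[R]_D is the sup norm: it is used below only for the
   topology, whereas distances and angles are Euclidean. *)
Definition dotprod (R : realType) D (x y : 'rV[R]_D) : R :=
  \sum_(i < D) x ord0 i * y ord0 i.

Definition enorm (R : realType) D (x : 'rV[R]_D) : R := Num.sqrt (dotprod x x).

Definition edist (R : realType) D (x y : 'rV[R]_D) : R := enorm (x - y).

Definition similarity (R : realType) D (c : R) (f : 'rV[R]_D -> 'rV[R]_D) : Prop :=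
  forall x y, edist (f x) (f y) = c * edist x y.

(* gamma is the full apex angle; u is the unit vector directing the axis. *)
Definition open_cone (R : realType) D (x u : 'rV[R]_D) (gamma l : R) :
    set 'rV[R]_D :=
  [set y | cos (gamma / 2) * enorm (y - x) < dotprod (y - x) u < l].

(* gdms_map v w is the similarity of R^D whose restriction to X_w is
   phi_(v,w); its values when (v, w) is not an edge are irrelevant. *)
Record linear_gdms (R : realType) (d D : nat) := LinearGDMS {
  gdms_set : letter d -> set 'rV[R]_D;
  gdms_map : letter d -> letter d -> 'rV[R]_D -> 'rV[R]_D;
  gdms_ratio : letter d -> R;
  gdms_nonempty : forall v, gdms_set v !=set0;
  gdms_compact : forall v, compact (gdms_set v);
  gdms_ratio_itv : forall v, 0 < gdms_ratio v < 1;
  gdms_similarity : forall v w, edge v w ->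
    similarity (gdms_ratio v) (gdms_map v w);
  gdms_maps_to : forall v w, edge v w ->
    gdms_map v w @` gdms_set w `<=` gdms_set v;
  gdms_connected : forall v, connected (gdms_set v);
  gdms_regular : forall v, gdms_set v = closure (interior (gdms_set v));
  gdms_osc : forall v w v' w', edge v w -> edge v' w' -> (v, w) <> (v', w') ->
    (gdms_map v w @` interior (gdms_set w)) `&`
    (gdms_map v' w' @` interior (gdms_set w')) = set0;
  gdms_cone : exists l gamma : R, [/\ 0 < l, 0 < gamma < pi / 2
    & forall v x, gdms_set v x -> exists u : 'rV[R]_D,
        enorm u = 1 /\ open_cone x u gamma l `<=` interior (gdms_set v)] }.

Section LimitSets.
Variables (R : realType) (d D : nat) (Phi : linear_gdms R d D).
Implicit Type om : nat -> letter d * letter d.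

Definition fg_ratio (g : free_group d) : R :=
  \prod_(v <- word g) gdms_ratio Phi v.

Definition critical_exponent (H : set (free_group d)) : \bar R :=
  ereal_inf [set t%:E | t in [set t : R | 0 <= t /\
    (\esum_(h in H) (fg_ratio h `^ t)%:E < +oo)%E]].

(* Indices start at 0: om i is the (i+1)-st edge of the sequence. *)
Definition coding_space : set (nat -> letter d * letter d) :=
  [set om | forall i, edge (om i).1 (om i).2 /\ (om i).2 = (om i.+1).1].

Fixpoint map_prefix om (n : nat) : 'rV[R]_D -> 'rV[R]_D :=
  if n is m.+1
  then map_prefix om m \o gdms_map Phi (om m).1 (om m).2
  else id.

Definition cylinder om (n : nat) : set 'rV[R]_D :=
  map_prefix om n.+1 @` gdms_set Phi (om n).2.

(* The disjoint union of the X_v is seen inside V * R^D; for om in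
   coding_space the intersection below is a singleton. *)
Definition coding_map om : letter d * 'rV[R]_D :=
  ((om 0%N).1, get (\bigcap_n cylinder om n)).

Definition word_prefix om (n : nat) : free_group d :=
  (\prod_(i < n) of_letter (om i).1)%g.

Definition radial_limit_set (H : set (free_group d)) :
    set (letter d * 'rV[R]_D) :=
  coding_map @` [set om | coding_space om /\ exists gamma : free_group d,
    infinite_set [set n | exists2 h, H h &
      word_prefix om n.+1 = (h * gamma)%g]].

Definition uniformly_radial_limit_set (H : set (free_group d)) :
    set (letter d * 'rV[R]_D) :=
  coding_map @` [set om | coding_space om /\ exists Gamma : set (free_group d),
    finite_set Gamma /\ forall n, exists h gamma,
      [/\ H h, Gamma gamma & word_prefix om n.+1 = (h * gamma)%g]].

(* Points in different components of the disjoint union are infinitely far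
   apart. *)
Definition union_edist (p q : letter d * 'rV[R]_D) : \bar R :=
  if p.1 == q.1 then (edist p.2 q.2)%:E else +oo%E.

End LimitSets.

Section Hausdorff.
Context {R : realType} {T : Type}.
Variable dist : T -> T -> \bar R.
Local Open Scope ereal_scope.

Definition ediam (A : set T) : \bar R :=
  ereal_sup [set dist x y | x in A & y in A].

(* diam(A)^s, with 0^0 = 1 for nonempty A, and 0 for the empty set. *)
Definition diam_power (s : R) (A : set T) : \bar R :=
  if `[< A = set0 >] then 0 else poweR (ediam A) s.

Definition hausdorff_premeasure (s delta : R) (A : set T) : \bar R :=
  ereal_inf [set \sum_(0 <= i <oo) diam_power s (U i) | U in
    [set U : nat -> set T |
      A `<=` \bigcup_i U i /\ forall i, ediam (U i) <= delta%:E]].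

Definition hausdorff_measure (s : R) (A : set T) : \bar R :=
  ereal_sup [set hausdorff_premeasure s delta A | delta in
    [set delta : R | (0 < delta)%R]].

Definition hausdorff_dim (A : set T) : \bar R :=
  ereal_inf [set s%:E | s in
    [set s : R | (0 <= s)%R /\ hausdorff_measure s A = 0]].

End Hausdorff.

(* Main.v *)
From HB Require Import structures.
From Pilot Require Import Defs.
From mathcomp Require Import all_boot all_order all_algebra.
From mathcomp Require Import all_classical all_reals all_analysis.
From mathcomp Require Import ring lra zify.

(** Write delta for the critical exponent of N and c for the contraction ratio.

    Upper bound, dim Lambda_r <= delta ([radial_null]).  A radial point whose
    code has infinitely many prefixes in N g lies, for infinitely many h in N,
    in the set of points coded by a sequence with prefix h g; that set has
    diameter at most a constant times c(h g).  Since c is supermultiplicative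
    (a cancellation only removes factors smaller than 1), c(h g) is at most a
    constant depending on g times c(h).  Hence if the Poincare series of N
    converges at t, then for each of the countably many g a tail of the series
    bounds the t-dimensional cost of a cover by arbitrarily small sets, and the
    t-dimensional measure of Lambda_r is zero.

    The inclusion of Lambda_ur in Lambda_r is the pigeonhole principle.

    Lower bound, delta <= dim Lambda_ur ([divergence_lower_bound]).  Let s < t
    and let the Poincare series of N diverge at t.  Group the elements of N by
    length n, first letter a and last letter b.  As c(h)^t <= rho^n c(h)^s with
    rho < 1, some class has an s-sum as large as we like.  Normality provides,
    for every a and b, a word k in N such that x k can be followed by a without
    cancellation whenever x begins with a and ends with b: conjugate a
    nontrivial element of N by two well-chosen letters ([connecting_word]).
    The words x k, x in the class, belong to N, have the same length, and can be
    concatenated freely; every infinite concatenation is the code of a point of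
    Lambda_ur, because each of its prefixes is an element of N followed by a
    proper prefix of one of finitely many words.  The maps of these words form
    a finite iterated function system of similarities with the open set
    condition whose ratios satisfy sum r_i^s >= 1, so Moran's argument shows
    that its limit set has positive s-dimensional measure
    ([moran_lower_bound], [subsystem_lower_bound]).

    Moran's argument is carried out without constructing a measure or computing
    volumes.  A set of diameter rho meets boundedly many cylinders of size about
    rho, because these have reference points that are separated by a multiple of
    rho and hence lie in different cells of a grid ([few_cylinders]).  So a cover
    of the limit set with small s-dimensional cost would give a cover of the
    sequence space by cylinders of total mass less than 1 for the product weights
    r_i^s / sum r_j^s.  Going down the tree of words, always to a child for which
    the cylinders inside have less mass than the child itself, one reaches a
    sequence that is not covered ([cylinder_cover_ge1]). *)

(* [edist] is the Euclidean distance, not the extended pseudometric of the same name. *)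
Import Pilot.Defs.

Set Implicit Arguments.
Unset Strict Implicit.
Unset Printing Implicit Defensive.

Import Order.TTheory GRing.Theory Num.Theory.
Import numFieldNormedType.Exports.

Local Open Scope classical_set_scope.
Local Open Scope ring_scope.

(** * Unordered sums and Hausdorff measures *)

Section Esum.
Context {R : realType} {J : choiceType}.
Implicit Types (P : set J) (a : J -> \bar R).

Lemma le_esum_subset P P' a : (forall j, P' j -> (0 <= a j)%E) -> P `<=` P' ->
  (\esum_(j in P) a j <= \esum_(j in P') a j)%E.
Proof.
move=> a0 PP'; rewrite [leLHS]esum_mkcond [leRHS]esum_mkcond; apply: le_esum => j _.
case: ifPn => [/set_mem Pj|_]; first by rewrite mem_set //; exact: PP'.
by case: ifPn => // /set_mem; exact: a0.
Qed.

Lemma esumZl_le P a (k : R) : 0 <= k -> (forall j, (0 <= a j)%E) ->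
  (\esum_(j in P) (k%:E * a j) <= k%:E * \esum_(j in P) a j)%E.
Proof.
move=> k0 a0; apply: ge_ereal_sup => _ [F [finF FP] <-].
rewrite fsbig_finite // -ge0_sume_distrr //; apply: lee_wpmul2l; first by rewrite lee_fin.
by apply: esum_ge; exists F => //; rewrite fsbig_finite.
Qed.

Lemma esum_tail P a (e : R) : (forall j, (0 <= a j)%E) -> 0 < e ->
    (\esum_(j in P) a j < +oo)%E ->
  exists2 F : set J, finite_set F & (\esum_(j in P `&` ~` F) a j <= e%:E)%E.
Proof.
move=> a0 e0 sum_fin; have esum0 Q : (0 <= \esum_(j in Q) a j)%E by apply: esum_ge0.
have S_fin : \esum_(j in P) a j \is a fin_num by rewrite ge0_fin_numE.
have [_ [F [finF FP] <-] F_lt] := ub_ereal_sup_adherent e0 S_fin.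
exists F => //; move: F_lt; rewrite -[X in (X - _)%E]/(\esum_(j in P) a j).
have -> : \esum_(j in P) a j = (\sum_(j \in F) a j + \esum_(j in P `&` ~` F) a j)%E.
  by rewrite (esumID F) // (setIidr FP) esum_fset.
have T_fin : \esum_(j in P `&` ~` F) a j \is a fin_num.
  rewrite ge0_fin_numE //; apply: le_lt_trans sum_fin.
  exact: (le_esum_subset (fun j _ => a0 j) (@subIsetl _ P (~` F))).
have F_fin : \sum_(j \in F) a j \is a fin_num.
  rewrite -esum_fset // ge0_fin_numE //; apply: le_lt_trans sum_fin.
  exact: (le_esum_subset (fun j _ => a0 j) FP).
rewrite -(fineK T_fin) -(fineK F_fin) -!EFinD lte_fin lee_fin; lra.
Qed.

End Esum.

Section HausdorffMeasure.
Context {R : realType} {T : Type} (dist : T -> T -> \bar R).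
Implicit Types (A B : set T) (s delta : R).
Local Open Scope ereal_scope.

Lemma diam_power_ge0 s A : 0 <= diam_power dist s A.
Proof. by rewrite /diam_power; case: asboolP => // _; exact: poweR_ge0. Qed.

Lemma hausdorff_premeasure_ge0 s delta A : 0 <= hausdorff_premeasure dist s delta A.
Proof.
apply: le_ereal_inf_tmp => _ [U _ <-].
by apply: nneseries_ge0 => n _ _; exact: diam_power_ge0.
Qed.

Lemma hausdorff_measure_ge0 s A : 0 <= hausdorff_measure dist s A.
Proof.
apply: le_trans (hausdorff_premeasure_ge0 s 1 A) _.
by apply: ereal_sup_ubound; exists 1%R => //=.
Qed.

Lemma hausdorff_measure_subset s A B : A `<=` B ->
  hausdorff_measure dist s A <= hausdorff_measure dist s B.
Proof.
move=> AB; apply: ge_ereal_sup => _ [delta delta0 <-].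
apply: (@le_trans _ _ (hausdorff_premeasure dist s delta B)); last first.
  by apply: ereal_sup_ubound; exists delta.
apply: ereal_inf_le_tmp => _ [U [BU Ud] <-]; exists U => //; split => //.
exact: subset_trans BU.
Qed.

Lemma hausdorff_dim_subset A B : A `<=` B -> hausdorff_dim dist A <= hausdorff_dim dist B.
Proof.
move=> AB; apply: ereal_inf_le_tmp => _ [s [s0 sB] <-]; exists s => //; split => //.
apply/eqP; rewrite eq_le hausdorff_measure_ge0 andbT -sB.
exact: hausdorff_measure_subset.
Qed.

(** Covers may be indexed by part of any countable type: the indices of the
    given sequence of sets that code no element of [P] receive the empty set,
    which costs nothing even for s = 0. *)
Lemma hausdorff_premeasure_le_esum (J : countType) (P : set J) (U : J -> set T) s delta A :
    A `<=` \bigcup_(j in P) U j -> (forall j, P j -> ediam dist (U j) <= delta%:E) ->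
  hausdorff_premeasure dist s delta A <= \esum_(j in P) diam_power dist s (U j).
Proof.
move=> AU Ud; pose V n := [set x | exists j, [/\ P j, pickle j = n & U j x]].
have VE j : P j -> V (pickle j) = U j.
  move=> Pj; apply/seteqP; split=> [x [k [_ /(pcan_inj pickleK) -> //]]|x Ujx].
  by exists j.
have V0 n : ~ (pickle @` P) n -> V n = set0.
  by move=> nP; apply/seteqP; split => // x [j [Pj jn _]]; apply: nP; exists j.
have -> : \esum_(j in P) diam_power dist s (U j) = \sum_(0 <= n <oo) diam_power dist s (V n).
  rewrite nneseries_esumT => [|n]; last exact: diam_power_ge0.
  rewrite (_ : \esum_(n in [set: nat]) _ = \esum_(n in pickle @` P) diam_power dist s (V n)).
    rewrite esum_image; last by move=> ? ? _ _; exact: (pcan_inj pickleK).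
    by apply: eq_esum => j Pj; rewrite VE.
  rewrite [RHS]esum_mkcond; apply: eq_esum => n _; case: ifPn => // /negP nP.
  by rewrite V0 ?/diam_power ?asboolT // => Pn; apply: nP; rewrite inE.
apply: ereal_inf_lbound; exists V => //; split=> [x /AU[j Pj Ujx]|n].
  by exists (pickle j) => //; exists j.
have [[j Pj <-]|nP] := pselect ((pickle @` P) n); first by rewrite VE //; exact: Ud.
rewrite V0 //; apply: ge_ereal_sup => _ [x []].
Qed.

End HausdorffMeasure.

(** * Mass distribution on a tree of words *)

Section MassDistribution.
Context {R : realType} {I G : finType}.
Implicit Types (p : I -> R) (t u : seq I) (om : nat -> I).

Local Notation weight p s := (\prod_(i <- s) p i).

(** The total mass of the listed cylinders that are contained in the cylinder
    of [t]. *)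
Definition below p (A : set nat) (L : nat -> G -> seq I) t : \bar R :=
  \esum_(j in A) \sum_(g | prefix t (L j g)) (weight p (L j g))%:E.

Lemma prefix_rcons_eq t i j u :
  prefix (rcons t i) u -> prefix (rcons t j) u -> i = j.
Proof.
rewrite -!cats1 => /prefixP[x ->] /prefixP[y]; rewrite -!catA => /eqP.
by rewrite eqseq_cat // eqxx /= => /eqP[].
Qed.

(** The mass of [t] is the sum of those of its children, and a listed cylinder
    lies below at most one child of [t]; so the deficit passes to some child. *)
Lemma below_child p A L t : (forall i, 0 <= p i) -> \sum_i p i = 1 ->
  (below p A L t < (weight p t)%:E)%E ->
  exists i, (below p A L (rcons t i) < (weight p (rcons t i))%:E)%E.
Proof.
move=> p0 p1 lt_t; have w0 u : 0 <= weight p u by apply: prodr_ge0.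
apply: contrapT => /forallNP no_child; suff : (below p A L t < below p A L t)%E.
  by rewrite ltxx.
apply: lt_le_trans lt_t _.
have -> : weight p t = \sum_i weight p (rcons t i).
  transitivity (weight p t * \sum_i p i); first by rewrite p1 mulr1.
  rewrite mulr_sumr; apply: eq_bigr => i _.
  by rewrite -cats1 big_cat big_seq1.
rewrite -sumEFin; apply: (@le_trans _ _ (\sum_i below p A L (rcons t i))%E).
  by apply: lee_sum => i _; rewrite leNgt; apply/negP/no_child.
rewrite -esum_sum; last by move=> *; apply: sume_ge0 => *; rewrite lee_fin.
apply: le_esum => j _; rewrite (exchange_big_dep (fun g => prefix t (L j g))) /=; last first.
  by move=> i g _; apply: prefix_trans; exact: prefix_rcons.
apply: lee_sum => g _; case: (pickP (fun i => prefix (rcons t i) (L j g))) => [i0 pi0|none].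
  rewrite (bigD1 i0) //= [X in (_ + X)%E]big1 ?adde0 // => i /andP[pi /eqP[]].
  exact: prefix_rcons_eq pi pi0.
by rewrite big1 ?lee_fin // => i; rewrite none.
Qed.

(** Countable subadditivity of the Bernoulli measure on the whole space, obtained
    by following deficits down the tree: the branch so found can belong to no
    listed cylinder, since a listed cylinder has no deficit. *)
Lemma cylinder_cover_ge1 p (A : set nat) (L : nat -> G -> seq I) :
    (forall i, 0 <= p i) -> \sum_i p i = 1 ->
    (forall om, exists j g n, A j /\ L j g = mkseq om n) ->
  (1 <= \esum_(j in A) \sum_g (weight p (L j g))%:E)%E.
Proof.
move=> p0 p1 cover; rewrite leNgt; apply/negP => lt1.
have w0 u : 0 <= weight p u by apply: prodr_ge0.
pose good t := (below p A L t < (weight p t)%:E)%E.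
have good0 : good [::].
  rewrite /good /below big_nil; apply: le_lt_trans lt1.
  by apply: le_esum => j _; rewrite (eq_bigl xpredT) // => g; exact: prefix0s.
have [[i0 _]|noI] := pselect (exists i : I, True); last first.
  move: p1; rewrite big1 => [/esym/eqP|i _]; first by rewrite oner_eq0.
  by case: noI; exists i.
pose next t := xget i0 [set i | good (rcons t i)].
pose node := fix node n := if n is m.+1 then rcons (node m) (next (node m)) else [::].
have node_good n : good (node n).
  elim: n => //= n /(below_child p0 p1) [i gi].
  by rewrite /next; case: xgetP => [j _ //|/(_ i)]; case.
pose om n := next (node n).
have nodeE n : node n = mkseq om n by elim: n => //= n IH; rewrite mkseqS -IH.
have [j [g [n [Aj Lj]]]] := cover om.
have := node_good n; rewrite /good nodeE -Lj ltNge => /negP; apply.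
apply: esum_ge; exists [set j]; first by split => // _ ->.
rewrite fsbig_set1 (bigD1 g) ?prefix_refl //= leeDl //.
by apply: sume_ge0 => *; rewrite lee_fin.
Qed.

Context {T : Type} (dist : T -> T -> \bar R).
Hypothesis dist_refl : forall x, dist x x = 0%E.

Lemma ediam_ge0 (U : set T) : U !=set0 -> (0 <= ediam dist U)%E.
Proof.
by move=> [x Ux]; rewrite -(dist_refl x); apply: ereal_sup_ubound; exists x => //; exists x.
Qed.

(** Sets of diameter 0 have no scale of their own: they are given a positive
    radius of negligible cost, or radius 1 when s = 0, where 0^0 = 1. *)
Lemma approx_radius (s e delta : R) (U : set T) : 0 <= s -> 0 < e -> U !=set0 ->
    (ediam dist U <= delta%:E)%E ->
  exists rho : R, [/\ 0 < rho, (ediam dist U <= rho%:E)%E &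
    ((rho `^ s)%:E <= diam_power dist s U + e%:E)%E].
Proof.
move=> s0 e0 U0 Udelta; have dU := ediam_ge0 U0.
have /fineK dE : ediam dist U \is a fin_num.
  by rewrite ge0_fin_numE // (le_lt_trans Udelta) ?ltry.
rewrite /diam_power; case: asboolP => [UE|_]; first by move: U0; rewrite UE => -[].
move: dU; rewrite -{}dE lee_fin le_eqVlt => /predU1P[<-|d_gt0]; last first.
  exists (fine (ediam dist U)); split => //.
  by rewrite poweR_EFin -EFinD lee_fin lerDl ltW.
move: s0; rewrite le_eqVlt => /predU1P[<-|s_gt0].
  exists 1; split => //.
  by rewrite poweR_EFin !powRr0 -EFinD lee_fin lerDl ltW.
exists (e `^ s^-1); split; rewrite ?powR_gt0 ?lee_fin ?powR_ge0 //.
by rewrite -powRrM mulVf ?gt_eqF // powRr1 ?(ltW e0) // lerDr powR_ge0.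
Qed.

(** The mass distribution principle in combinatorial form: [G] bounds the number
    of cylinders of ratio at most rho needed to cover a set of diameter rho, and a
    cylinder of ratio at most rho has mass at most rho^s. *)
Lemma mass_distribution (r : I -> R) (s : R) (pt : (nat -> I) -> T) (X : set T) :
    0 <= s -> (forall i, 0 < r i) -> 1 <= \sum_i r i `^ s ->
    (forall U rho, 0 < rho -> (ediam dist U <= rho%:E)%E ->
      exists L : G -> seq I, (forall g, weight r (L g) <= rho) /\
        forall om, U (pt om) -> exists g n, L g = mkseq om n) ->
    range pt `<=` X ->
  hausdorff_measure dist s X <> 0%E.
Proof.
move=> s0 r0 sum_ge1 small_cover ptX hX0.
(* With cost less than [e] and error [e], the total mass is below 2 e K < 1. *)
pose K : R := #|G|%:R; pose e := (2 * (K + 1))^-1.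
have K0 : 0 <= K by rewrite ler0n.
have e0 : 0 < e by rewrite invr_gt0 mulr_gt0 // ltr_wpDl.
have : (hausdorff_premeasure dist s 1 X < e%:E)%E.
  apply: (@le_lt_trans _ _ 0%E); last by rewrite lte_fin.
  by rewrite -hX0; apply: ereal_sup_ubound; exists 1 => //=.
move=> /ereal_inf_lt[_ [U [XU Ud] <-] sumU].
pose A := [set j | U j !=set0].
have /choice [rho rhoP] : forall j, exists rho : R, A j ->
    [/\ 0 < rho, (ediam dist (U j) <= rho%:E)%E &
    ((rho `^ s)%:E <= diam_power dist s (U j) + (e / (2 ^ j.+1)%:R)%:E)%E].
  move=> j; have [Aj|nAj] := pselect (A j); last by exists 0.
  have [|rho [? ? ?]] := @approx_radius s (e / (2 ^ j.+1)%:R) 1 (U j) s0 _ Aj (Ud j).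
    by rewrite divr_gt0 // ltr0n expn_gt0.
  by exists rho.
have /choice [L LP] : forall j, exists L : G -> seq I, A j ->
    (forall g, weight r (L g) <= rho j) /\
    forall om, U j (pt om) -> exists g n, L g = mkseq om n.
  move=> j; have [Aj|nAj] := pselect (A j); last by exists (fun=> [::]).
  have [rho0 dU _] := rhoP j Aj.
  by have [L LP] := small_cover _ _ rho0 dU; exists L.
pose Z := \sum_i r i `^ s; pose p i := r i `^ s / Z.
have Z0 : 0 < Z by rewrite (lt_le_trans ltr01).
have p0 i : 0 <= p i by rewrite divr_ge0 ?powR_ge0 // ltW.
have p1 : \sum_i p i = 1 by rewrite -mulr_suml mulfV ?gt_eqF.
have wp t : weight p t <= weight r t `^ s.
  elim: t => [|i t IH]; first by rewrite !big_nil powR1.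
  have w0 : 0 <= weight r t by apply: prodr_ge0 => j _; apply: ltW.
  rewrite !big_cons powRM ?(ltW (r0 i)) //; apply: ler_pM => //; first by apply: prodr_ge0.
  by rewrite ler_pdivrMr // ler_peMr // powR_ge0.
have cover om : exists j g n, A j /\ L j g = mkseq om n.
  have [j _ Uj] : (\bigcup_j U j) (pt om) by apply: XU; apply: ptX; exists om.
  have Aj : A j by exists (pt om).
  by have [_ /(_ om Uj)[g [n ?]]] := LP j Aj; exists j, g, n.
have := cylinder_cover_ge1 p0 p1 cover; rewrite leNgt => /negP; apply.
pose b j := (diam_power dist s (U j) + (e / (2 ^ j.+1)%:R)%:E)%E.
have b0 j : (0 <= b j)%E.
  by rewrite adde_ge0 ?diam_power_ge0 // lee_fin divr_ge0 // ltW.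
apply: (@le_lt_trans _ _ (\esum_(j in [set: nat]) (K%:E * b j))%E).
  rewrite [leLHS]esum_mkcond; apply: le_esum => j _; case: ifPn => [/set_mem Aj|_]; last first.
    by rewrite mule_ge0 // lee_fin.
  have [rho_gt0 _ rhos] := rhoP j Aj; have [Lrho _] := LP j Aj.
  apply: (@le_trans _ _ (\sum_(g : G) b j)%E).
    apply: lee_sum => g _; apply: le_trans rhos; rewrite lee_fin.
    apply: le_trans (wp _) _; apply: ge0_ler_powR; rewrite ?nnegrE //; last exact: ltW.
    by apply: prodr_ge0 => i _; exact: ltW.
  rewrite big_const /K; elim: #|G| => [|n IH]; first by rewrite mul0e.
  by rewrite iterS -nat1r EFinD ge0_muleDl ?lee_fin // mul1e leeD2l.
rewrite -nneseries_esumT => [|j]; last by rewrite mule_ge0 // lee_fin.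
rewrite nneseriesZl //; apply: (@le_lt_trans _ _ (K%:E * (e%:E + e%:E))%E).
  rewrite lee_wpmul2l ?lee_fin //.
  apply: (@le_trans _ _ (\sum_(0 <= j <oo) diam_power dist s (U j) + e%:E)%E).
    by apply: epsilon_trick => [j|]; [exact: diam_power_ge0 | exact: ltW].
  by rewrite leeD2r // ltW.
rewrite -EFinD -EFinM lte_fin /e.
rewrite -[X in X < _](_ : K / (K + 1) = _); last first.
  by field; rewrite gt_eqF // ltr_wpDl.
by rewrite ltr_pdivrMr ?ltr_wpDl // mul1r ltrDl.
Qed.

End MassDistribution.

(** * Similarities of Euclidean space *)

Section Similarities.
Context {R : realType} {D : nat}.
Implicit Types (x y z : 'rV[R]_D) (f g : 'rV[R]_D -> 'rV[R]_D).

Lemma dotprod_ge0 x : 0 <= dotprod x x.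
Proof. by apply: sumr_ge0 => i _; rewrite -expr2 sqr_ge0. Qed.

Lemma dotprod_subr x y :
  dotprod (x - y) (x - y) = dotprod x x + dotprod y y - 2 * dotprod x y.
Proof.
rewrite /dotprod mulr_sumr -big_split -sumrB; apply: eq_bigr => i _ /=.
by rewrite !mxE; ring.
Qed.

Lemma enorm_sqr x : enorm x ^+ 2 = dotprod x x.
Proof. by rewrite sqr_sqrtr // dotprod_ge0. Qed.

Lemma enormZ a x : 0 <= a -> enorm (a *: x) = a * enorm x.
Proof.
move=> a0; rewrite /enorm -[X in X * _]ger0_norm // -sqrtr_sqr -sqrtrM ?sqr_ge0 //.
rewrite /dotprod mulr_sumr; congr Num.sqrt; apply: eq_bigr => i _.
by rewrite !mxE; ring.
Qed.

Lemma enorm_ge0 x : 0 <= enorm x. Proof. exact: sqrtr_ge0. Qed.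

Lemma enorm0 : enorm (0 : 'rV[R]_D) = 0.
Proof. by rewrite /enorm /dotprod big1 ?sqrtr0 // => i _; rewrite mxE mul0r. Qed.

Lemma enorm0_eq0 x : enorm x = 0 -> x = 0.
Proof.
move=> x0; have : dotprod x x = 0 by rewrite -enorm_sqr x0 expr0n.
move/eqP; rewrite psumr_eq0 => [/allP x0i|i _]; last by rewrite -expr2 sqr_ge0.
apply/rowP => i; rewrite mxE; have := x0i i; rewrite mem_index_enum mulf_eq0 orbb.
by move=> /(_ isT)/eqP.
Qed.

Lemma normr_coord_le x i : `|x ord0 i| <= enorm x.
Proof.
rewrite -sqrtr_sqr ler_wsqrtr // /dotprod (bigD1 i) //= -expr2 lerDl.
by apply: sumr_ge0 => j _; rewrite -expr2 sqr_ge0.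
Qed.

Lemma enorm_le_sum x : enorm x <= \sum_i `|x ord0 i|.
Proof.
have s0 : 0 <= \sum_i `|x ord0 i| by apply: sumr_ge0.
rewrite -[leRHS]ger0_norm // -sqrtr_sqr ler_wsqrtr // expr2 mulr_suml.
apply: ler_sum => i _; apply: le_trans (ler_norm _) _; rewrite normrM ler_wpM2l //.
by rewrite (bigD1 i) //= lerDl; apply: sumr_ge0.
Qed.

Lemma edist_refl x : edist x x = 0.
Proof. by rewrite /edist subrr enorm0. Qed.

Lemma edist_ge0 x y : 0 <= edist x y. Proof. exact: enorm_ge0. Qed.

Lemma similarity_id : similarity 1 (id : 'rV[R]_D -> _).
Proof. by move=> x y; rewrite mul1r. Qed.

Lemma similarity_comp a b f g :
  similarity a f -> similarity b g -> similarity (a * b) (f \o g).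
Proof. by move=> sf sg x y; rewrite /= sf sg mulrA. Qed.

Lemma similarity_inj c f : 0 < c -> similarity c f -> injective f.
Proof.
move=> c0 sf x y fxy; apply/eqP; rewrite -subr_eq0; apply/eqP/enorm0_eq0.
have /eqP := sf x y; rewrite fxy edist_refl eq_sym mulf_eq0 gt_eqF //=.
by move=> /eqP.
Qed.

(** A map that fixes 0 and preserves norms of differences preserves dot products
    by polarization.  It thus sends the canonical basis to an orthonormal one, and
    [Q] is the matrix of the latter: since Q^T is a right inverse of Q it is also
    a left inverse, so the map is multiplication by Q. *)
Lemma similarity_affine c f : 0 < c -> similarity c f ->
  exists2 Q : 'M[R]_D, Q \in unitmx & forall x, f x = f 0 + c *: (x *m Q).
Proof.
move=> c0 sf; pose g x := c^-1 *: (f x - f 0).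
have gnorm x y : enorm (g x - g y) = enorm (x - y).
  rewrite /g -scalerBr opprB addrA subrK.
  rewrite enormZ ?invr_ge0 ?ltW //.
  by have := sf x y; rewrite /edist => ->; rewrite mulKf ?gt_eqF.
have g0 : g 0 = 0 by rewrite /g subrr scaler0.
have gnorm0 x : enorm (g x) = enorm x by have := gnorm x 0; rewrite g0 !subr0.
have gdot x y : dotprod (g x) (g y) = dotprod x y.
  have := dotprod_subr (g x) (g y); rewrite -!enorm_sqr gnorm !gnorm0 !enorm_sqr.
  rewrite dotprod_subr; lra.
pose e i : 'rV[R]_D := delta_mx ord0 i.
pose Q : 'M[R]_D := \matrix_i g (e i).
have gQ x : g x *m Q^T = x.
  apply/rowP => i; transitivity (dotprod (g x) (g (e i))).
    by rewrite mxE; apply: eq_bigr => j _; rewrite !mxE.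
  rewrite gdot /dotprod (bigD1 i) //= big1 => [|j ji].
    by rewrite mxE !eqxx mulr1 addr0.
  by rewrite mxE (negbTE ji) andbF mulr0.
have QQ : Q *m Q^T = 1%:M.
  apply/row_matrixP => i; rewrite row_mul rowK gQ; apply/rowP => j.
  by rewrite !mxE eqxx eq_sym.
exists Q; first by case: (mulmx1_unit QQ).
move=> x; have -> : x *m Q = g x by rewrite -{1}(gQ x) -mulmxA (mulmx1C QQ) mulmx1.
by rewrite /g scalerA mulfV ?gt_eqF // scale1r addrC subrK.
Qed.

Lemma similarity_surj c f y : 0 < c -> similarity c f -> exists x, f x = y.
Proof.
move=> c0 /(similarity_affine c0)[Q Qu fE].
exists (c^-1 *: (y - f 0) *m invmx Q); rewrite fE mulmxKV // scalerA.
by rewrite mulfV ?gt_eqF // scale1r addrC subrK.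
Qed.

End Similarities.

Section EuclideanTopology.
Context {R : realType} {D : nat}.
Implicit Types (x y z : 'rV[R]_D) (A : set 'rV[R]_D) (f : 'rV[R]_D -> 'rV[R]_D).

(** The Euclidean norm and the sup norm define the same topology. *)
Lemma nbhs_edistP x A :
  nbhs x A <-> exists2 e : R, 0 < e & forall y, edist x y < e -> A y.
Proof.
split=> [/nbhs_ballP[e /= e0 xeA]|[e e0 xeA]].
  exists e => // y xy; apply: xeA; split => // i j; rewrite ord1.
  rewrite -ball_normE /= -[X in `|X|](_ : (x - y) ord0 j = _); last by rewrite !mxE.
  exact: le_lt_trans (normr_coord_le _ _) xy.
apply/nbhs_ballP; exists (e / D.+1%:R) => [/=|y [_ xy]]; first by rewrite divr_gt0.
apply: xeA; apply: le_lt_trans (enorm_le_sum _) _.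
apply: (@le_lt_trans _ _ (\sum_(i < D) e / D.+1%:R)).
  apply: ler_sum => i _; have := xy ord0 i; rewrite -ball_normE /= !mxE; exact: ltW.
rewrite sumr_const card_ord -[ltLHS]mulr_natl mulrCA -ltr_pdivlMl // mulVf ?gt_eqF //.
by rewrite ltr_pdivrMr // mul1r ltr_nat.
Qed.

Lemma similarity_continuous c f : 0 < c -> similarity c f -> continuous f.
Proof.
move=> c0 sf x A /nbhs_edistP[e e0 xeA]; apply/nbhs_edistP.
exists (e / c) => [|y xy]; first by rewrite divr_gt0.
by apply: xeA; rewrite sf mulrC -ltr_pdivlMr.
Qed.

(** Surjectivity of similarities makes the image of a ball a ball. *)
Lemma similarity_interior c f A :
  0 < c -> similarity c f -> f @` interior A `<=` interior (f @` A).
Proof.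
move=> c0 sf _ [x /nbhs_edistP[e e0 xeA] <-]; apply/nbhs_edistP.
exists (c * e) => [|y xy]; first by rewrite mulr_gt0.
have [z zE] := similarity_surj y c0 sf.
by exists z => //; apply: xeA; move: xy; rewrite -zE sf ltr_pM2l.
Qed.

Lemma compact_edist_bounded A : compact A ->
  exists2 Delta : R, 0 <= Delta & forall x y, A x -> A y -> edist x y <= Delta.
Proof.
move=> /compact_bounded /ex_strict_bound_gt0[M M0 AM].
exists (D%:R * (M + M)) => [|x y Ax Ay].
  by rewrite mulr_ge0 ?addr_ge0 ?(ltW M0).
have coord z i : A z -> `|z ord0 i| <= M.
  move=> /AM /= /ltW; apply: le_trans.
  rewrite [leRHS]mx_normrE.
  exact: (le_bigmax _ (fun ij : 'I_1 * 'I_D => `|z ij.1 ij.2|) (ord0, i)).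
apply: le_trans (enorm_le_sum _) _; rewrite mulr_natl -[X in _ *+ X]card_ord -sumr_const.
apply: ler_sum => i _; rewrite !mxE; apply: le_trans (ler_normB _ _) _.
by rewrite lerD // coord.
Qed.

Lemma nested_compact_bigcap (C : nat -> set 'rV[R]_D) :
    (forall n, compact (C n)) -> (forall n, C n !=set0) ->
    (forall n, C n.+1 `<=` C n) ->
  \bigcap_n C n !=set0.
Proof.
move=> cC /choice[u Cu] dC.
have decr m n : (m <= n)%N -> C n `<=` C m.
  by move/subnK <-; elim: (n - m)%N => // k IH x /dC /IH.
have [|p [_ pu]] := cC 0%N (u @ \oo) _.
  by exists 0%N => // n _; apply: (decr 0%N n).
exists p => n _; have cl : closed (C n) := compact_closed (@norm_hausdorff _ _) (cC n).
rewrite (iffLR (closure_id _) cl) => V Vp; apply: pu => //.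
by exists n => // k /= nk; apply: decr nk _ _.
Qed.

End EuclideanTopology.

(** * Moran's lower bound *)

Section Moran.
Context {R : realType} {D : nat} {I : finType}.
Variables (f : I -> 'rV[R]_D -> 'rV[R]_D) (r : I -> R) (rmin rmax : R).
Hypothesis f_sim : forall i, similarity (r i) (f i).
Hypothesis rmin_gt0 : 0 < rmin.
Hypothesis rmax_lt1 : rmax < 1.
Hypothesis r_bounds : forall i, rmin <= r i <= rmax.
Implicit Types (t u : seq I) (om : nat -> I) (x y z : 'rV[R]_D).

Local Notation weight t := (\prod_(i <- t) r i).

Definition word_map t : 'rV[R]_D -> 'rV[R]_D := foldr (fun i g => f i \o g) id t.

Lemma word_map_cat t u : word_map (t ++ u) = word_map t \o word_map u.
Proof. by elim: t => //= i t ->. Qed.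

Lemma r_gt0 i : 0 < r i.
Proof. by have /andP[+ _] := r_bounds i; exact: lt_le_trans. Qed.

Lemma weight_gt0 t : 0 < weight t.
Proof. by apply: prodr_gt0 => i _; exact: r_gt0. Qed.

Lemma word_map_sim t : similarity (weight t) (word_map t).
Proof.
elim: t => [|i t IH] /=; first by rewrite big_nil; exact: similarity_id.
by rewrite big_cons; exact: similarity_comp.
Qed.

(** The stopping words at scale [rho] cut every branch at the first node whose
    ratio is at most [rho]; they are the cylinders of size about [rho]. *)
Definition stopping rho t :=
  weight t <= rho /\ forall k, (k < size t)%N -> rho < weight (take k t).

Lemma stopping_exists rho om : 0 < rho -> exists n, stopping rho (mkseq om n).
Proof.
move=> rho0; have ex : exists n, weight (mkseq om n) <= rho.
  have rmax0 : 0 <= rmax.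
    by have /andP[rm rM] := r_bounds (om 0%N); apply: le_trans rM; exact: le_trans (ltW _) rm.
  have := @cvg_expr R rmax; rewrite ger0_norm // => /(_ rmax_lt1).
  move=> /cvgr0Pnorm_lt /(_ _ rho0) [n _ /(_ n (leqnn n)) /=] rn.
  exists n; apply: le_trans (ltW (le_lt_trans (ler_norm _) rn)).
  elim: n {rn} => [|n IH]; first by rewrite big_nil expr0.
  rewrite mkseqS -cats1 big_cat big_seq1 exprSr; apply: ler_pM => //.
  - exact: ltW (weight_gt0 _).
  - exact: ltW (r_gt0 _).
  - by have /andP[] := r_bounds (om n).
exists (ex_minn ex); case: ex_minnP => n wn min_n; split => // k.
rewrite size_mkseq => kn; rewrite ltNge; apply/negP => wk.
move: (min_n k); rewrite -(_ : take k (mkseq om n) = mkseq om k) => [/(_ wk)|].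
  by rewrite leqNgt kn.
by rewrite /mkseq -map_take take_iota (minn_idPl (ltnW kn)).
Qed.

Lemma stopping_prefix rho t u :
  stopping rho t -> stopping rho u -> prefix t u -> t = u.
Proof.
move=> [wt _] [_ u_early] tu; have tE : take (size t) u = t.
  by apply/eqP; rewrite -prefixE.
have := size_prefix tu; rewrite leq_eqVlt => /predU1P[st|/u_early].
  by rewrite -tE st take_size.
by rewrite tE ltNge wt.
Qed.

Lemma stopping_weight rho t :
  stopping rho t -> t != [::] -> rho * rmin < weight t.
Proof.
case/lastP: t => // t i [_ early] _.
have /early : (size t < size (rcons t i))%N by rewrite size_rcons.
rewrite -cats1 take_size_cat // => wt.
rewrite big_cat big_seq1; apply: (@lt_le_trans _ _ (weight t * rmin)).
  by rewrite ltr_pM2r.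
by rewrite ler_wpM2l ?(ltW (weight_gt0 _)) //; have /andP[] := r_bounds i.
Qed.

Lemma diverging t u : ~~ prefix t u -> ~~ prefix u t ->
  exists a i j t' u', [/\ t = a ++ i :: t', u = a ++ j :: u' & i != j].
Proof.
elim: t u => [|i t IH] [|j u] //=; rewrite ?prefix0s //.
case: eqVneq => [<-{j}|ij _ _]; last by exists [::], i, j, t, u.
move=> /= /IH{}IH /IH [a [k [l [t' [u' [-> -> kl]]]]]].
by exists (i :: a), k, l, t', u'.
Qed.

Variables (O : set 'rV[R]_D) (z0 : 'rV[R]_D) (eta : R).
Hypothesis eta_gt0 : 0 < eta.
Hypothesis ball_O : forall y, edist z0 y < eta -> O y.
Hypothesis f_O : forall i, f i @` O `<=` O.
Hypothesis f_disj : forall i j, i != j -> (f i @` O) `&` (f j @` O) = set0.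

Lemma word_map_O t x : O x -> O (word_map t x).
Proof. by elim: t => //= i t IH Ox; apply: f_O; exists (word_map t x) => //; exact: IH. Qed.

Lemma word_map_disj t u x y : ~~ prefix t u -> ~~ prefix u t -> O x -> O y ->
  word_map t x <> word_map u y.
Proof.
move=> tu ut Ox Oy; have [a [i [j [t' [u' [-> -> ij]]]]]] := diverging tu ut.
rewrite !word_map_cat /= => /(similarity_inj (weight_gt0 _) (word_map_sim a)) fij.
have : (f i @` O `&` f j @` O) (f i (word_map t' x)).
  split; first by exists (word_map t' x) => //; exact: word_map_O.
  by rewrite fij; exists (word_map u' y) => //; exact: word_map_O.
by rewrite f_disj.
Qed.

(** The image of the ball of radius [eta] around [z0] is the ball of radius
    [weight t * eta] around its image, and it cannot contain a point of the image
    of [O] under [word_map u] when the two words are incomparable. *)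
Lemma stopping_separated rho t u : 0 < rho -> stopping rho t -> stopping rho u ->
  t != u -> rho * (rmin * eta) <= edist (word_map t z0) (word_map u z0).
Proof.
move=> rho0 st su tu; rewrite leNgt; apply/negP => close.
have ntu : ~~ prefix t u by apply: contra tu => /(stopping_prefix st su) ->.
have nut : ~~ prefix u t.
  by apply: contra tu => /(stopping_prefix su st) ->.
have t0 : t != [::] by apply: contra ntu => /eqP ->; rewrite prefix0s.
have [y yE] := similarity_surj (word_map u z0) (weight_gt0 t) (word_map_sim t).
have Oz0 : O z0 by apply: ball_O; rewrite edist_refl.
suff Oy : O y by exact: word_map_disj ntu nut Oy Oz0 yE.
apply: ball_O; move: close; rewrite -yE word_map_sim mulrA => close.
rewrite -(ltr_pM2l (weight_gt0 t)); apply: lt_trans close _.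
by rewrite ltr_pM2r //; exact: stopping_weight.
Qed.

Variables (X : set 'rV[R]_D) (Delta : R).
Hypothesis X_bounded : forall x y, X x -> X y -> edist x y <= Delta.
Hypothesis O_X : O `<=` X.

Context {T : Type} (dist : T -> T -> \bar R).
Variables (pt : (nat -> I) -> T) (q : (nat -> I) -> 'rV[R]_D).
Hypothesis dist_q : forall om om',
  ((edist (q om) (q om'))%:E <= dist (pt om) (pt om'))%E.
Hypothesis q_cylinder : forall om n, (word_map (mkseq om n) @` X) (q om).

(** The reference points [word_map t z0] of the stopping words that matter for
    [U] lie in a cube of side proportional to [rho].  Cut it into cells whose
    diameter is less than the separation: each cell contains the reference point
    of at most one of these words, so the cells index the words. *)
Lemma few_cylinders (i0 : I) : exists K : nat,
  forall U rho, 0 < rho -> (ediam dist U <= rho%:E)%E ->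
  exists L : {ffun 'I_D -> 'I_K} -> seq I, (forall g, weight (L g) <= rho) /\
    forall om, U (pt om) -> exists g n, L g = mkseq om n.
Proof.
have Oz0 : O z0 by apply: ball_O; rewrite edist_refl.
have Delta0 : 0 <= Delta by rewrite -(edist_refl z0); apply: X_bounded; exact: O_X.
pose kappa := rmin * eta; have kappa0 : 0 < kappa by rewrite mulr_gt0.
(* The cells have side rho / Q, hence diameter at most D rho / Q < kappa rho. *)
pose Q : R := (Num.bound (D%:R / kappa)).+1%:R.
have Q0 : 0 < Q by rewrite ltr0n.
have DQ : D%:R / Q < kappa.
  rewrite ltr_pdivrMr // mulrC -ltr_pdivrMr //; apply: lt_trans (archi_boundP _) _.
    by rewrite divr_ge0 ?ler0n // ltW.
  by rewrite ltr_nat.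
pose B := 1 + Delta; pose K := Num.trunc (2 * B * Q).
exists K.+1 => U rho rho0 dU.
have [[om0 Uom0]|none] := pselect (exists om, U (pt om)); last first.
  have [n [wn _]] := stopping_exists (fun=> i0) rho0.
  by exists (fun=> mkseq (fun=> i0) n); split => // om Uom; case: none; exists om.
pose h t k := Num.trunc (((word_map t z0 - q om0) ord0 k + rho * B) / rho * Q).
have [n0 st0] := stopping_exists om0 rho0.
pose used t := stopping rho t /\ exists om n, U (pt om) /\ t = mkseq om n.
have coord t k : used t -> 0 <= ((word_map t z0 - q om0) ord0 k + rho * B) / rho * Q <= 2 * B * Q.
  move=> [[wt _] [om [n [Uom tE]]]].
  have [x Xx qx] := q_cylinder om n; rewrite -tE in qx.
  have b1 : `|(word_map t z0 - q om) ord0 k| <= rho * Delta.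
    apply: le_trans (normr_coord_le _ _) _; rewrite -qx -/(edist _ _) word_map_sim.
    by apply: ler_pM => //; rewrite ?edist_ge0 ?(ltW (weight_gt0 _)) // X_bounded //; exact: O_X.
  have b2 : `|(q om - q om0) ord0 k| <= rho.
    apply: le_trans (normr_coord_le _ _) _; rewrite -lee_fin.
    apply: le_trans (dist_q _ _) _; apply: le_trans dU.
    by apply: ereal_sup_ubound; exists (pt om) => //; exists (pt om0).
  have : `|(word_map t z0 - q om0) ord0 k| <= rho * B.
    have -> : word_map t z0 - q om0 = (word_map t z0 - q om) + (q om - q om0).
      by rewrite addrA subrK.
    rewrite mxE /B mulrDr mulr1; apply: le_trans (ler_normD _ _) _.
    by rewrite addrC lerD.
  rewrite ler_norml => /andP[lo hi]; apply/andP; split.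
    by apply: mulr_ge0 (ltW Q0); apply: divr_ge0 (ltW rho0); lra.
  by rewrite ler_pM2r // ler_pdivrMr //; lra.
have h_inj t u : used t -> used u -> (forall k, h t k = h u k) -> t = u.
  move=> ut uu htu; apply/eqP/negPn/negP => tu.
  have := stopping_separated rho0 ut.1 uu.1 tu; rewrite leNgt => /negP; apply.
  apply: (@le_lt_trans _ _ (rho * (D%:R / Q))); last by rewrite ltr_pM2l.
  apply: le_trans (enorm_le_sum _) _.
  have -> : rho * (D%:R / Q) = \sum_(k < D) rho / Q.
    by rewrite sumr_const card_ord -[RHS]mulr_natl; ring.
  apply: ler_sum => k _.
  have /andP[t0 _] := coord t k ut; have /andP[u0 _] := coord u k uu.
  have /andP[t1 t2] := trunc_itv t0; have /andP[u1 u2] := trunc_itv u0.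
  rewrite -/(h t k) in t1 t2; rewrite -/(h u k) -htu in u1 u2.
  have : `|((word_map t z0 - q om0) ord0 k + rho * B) / rho * Q -
           ((word_map u z0 - q om0) ord0 k + rho * B) / rho * Q| <= 1.
    by rewrite ler_norml -!natr1 in t2 u2 *; apply/andP; split; lra.
  have -> : ((word_map t z0 - q om0) ord0 k + rho * B) / rho * Q -
           ((word_map u z0 - q om0) ord0 k + rho * B) / rho * Q =
           (word_map t z0 - word_map u z0) ord0 k * (Q / rho).
    by rewrite !mxE; field; rewrite gt_eqF.
  rewrite normrM [X in _ * X]gtr0_norm ?divr_gt0 // -ler_pdivlMr ?divr_gt0 //.
  by rewrite div1r invf_div.
pose H t : {ffun 'I_D -> 'I_K.+1} := [ffun k => inord (h t k)].
(* Cells that contain no reference point receive an arbitrary stopping word. *)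
pose L g := xget (mkseq om0 n0) [set t | used t /\ H t = g].
have L_stop g : stopping rho (L g).
  by rewrite /L; case: xgetP => // t _ [[]].
exists L; split => [g|om Uom]; first by have [] := L_stop g.
have [n sn] := stopping_exists om rho0.
have un : used (mkseq om n) by split => //; exists om, n.
exists (H (mkseq om n)), n; rewrite /L; case: xgetP => [t _ [ut /ffunP Ht]|/(_ (mkseq om n))].
  apply: h_inj => // k; have := Ht k; rewrite !ffunE => /(congr1 val).
  have hK v : used v -> (h v k < K.+1)%N.
    by move=> /(coord _ k)/andP[_ /le_truncn]; rewrite ltnS.
  by rewrite /= !inordK ?hK.
by case.
Qed.

Theorem moran_lower_bound (dist_refl : forall p, dist p p = 0%E) (s : R) (A : set T) :
  0 <= s -> 1 <= \sum_i r i `^ s -> range pt `<=` A ->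
  hausdorff_measure dist s A <> 0%E.
Proof.
move=> s0 sum_ge1 ptA.
have [[i0 _]|noI] := pselect (exists i : I, True); last first.
  by move: sum_ge1; rewrite big1 ?ler10 // => i; case: noI; exists i.
have [K cyl] := few_cylinders i0.
exact: (mass_distribution dist_refl s0 r_gt0 sum_ge1 cyl ptA).
Qed.

End Moran.

(** * Cylinders of a graph directed system *)

Lemma finite_uniform_bounds (R : realType) (I : finType) (g : I -> R) :
    (forall i, 0 < g i < 1) ->
  exists cmin cmax : R, [/\ 0 < cmin, 0 <= cmax < 1 & forall i, cmin <= g i <= cmax].
Proof.
move=> g01.
have prod_le (h : I -> R) : (forall i, 0 < h i < 1) -> forall i, \prod_j h j <= h i.
  move=> h01 i; rewrite (bigD1 i) //= ler_piMr //; first by have /andP[/ltW] := h01 i.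
  by apply: prodr_ile1 => j _; have /andP[/ltW -> /ltW ->] := h01 j.
have prod_gt0 (h : I -> R) : (forall i, 0 < h i < 1) -> 0 < \prod_j h j <= 1.
  move=> h01; rewrite prodr_gt0 => [|i _]; last by have /andP[] := h01 i.
  by apply: prodr_ile1 => j _; have /andP[/ltW -> /ltW ->] := h01 j.
have g'01 i : 0 < 1 - g i < 1 by have := g01 i; lra.
(* A product of numbers in (0,1) is smaller than each of them. *)
exists (\prod_i g i), (1 - \prod_i (1 - g i)); split.
- by have /andP[] := prod_gt0 _ g01.
- by have := prod_gt0 _ g'01; lra.
- by move=> i; rewrite prod_le //=; have := prod_le _ g'01 i; lra.
Qed.

Section GDMS.
Context {R : realType} {d D : nat}.
Variable Phi : linear_gdms R d D.
Implicit Types (a v w : letter d) (s t : seq (letter d)).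
Implicit Type om : nat -> letter d * letter d.

Local Notation ratio := (gdms_ratio Phi).
Local Notation weight s := (\prod_(v <- s) gdms_ratio Phi v).

Lemma ratio_gt0 v : 0 < ratio v.
Proof. by have /andP[] := gdms_ratio_itv Phi v. Qed.

Lemma word_ratio_gt0 s : 0 < weight s.
Proof. by apply: prodr_gt0 => v _; exact: ratio_gt0. Qed.

Lemma ratio_bounds : exists cmin cmax : R, [/\ 0 < cmin, 0 <= cmax < 1 &
  forall s, cmin ^+ size s <= weight s <= cmax ^+ size s].
Proof.
have [cmin [cmax [c0 c1 cP]]] := finite_uniform_bounds (gdms_ratio_itv Phi).
exists cmin, cmax; split => // s; elim: s => [|v s IH]; first by rewrite !big_nil !expr0 lexx.
have /andP[v0 v1] := cP v; have /andP[s0 s1] := IH.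
rewrite big_cons /= !exprS ler_pM ?exprn_ge0 ?(ltW c0) //=.
by rewrite ler_pM // ltW // ?ratio_gt0 // word_ratio_gt0.
Qed.

Lemma gdms_diameter_bound :
  exists2 Delta : R, 0 <= Delta & forall v x y, gdms_set Phi v x ->
    gdms_set Phi v y -> edist x y <= Delta.
Proof.
have /choice[M MP] : forall v, exists M : R, 0 <= M /\ forall x y, gdms_set Phi v x ->
    gdms_set Phi v y -> edist x y <= M.
  by move=> v; have [M] := compact_edist_bounded (@gdms_compact _ _ _ Phi v); exists M.
exists (\sum_v M v) => [|v x y vx vy]; first by apply: sumr_ge0 => v _; case: (MP v).
apply: le_trans ((MP v).2 _ _ vx vy) _; rewrite (bigD1 v) //= lerDl.
by apply: sumr_ge0 => w _; case: (MP w).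
Qed.

Lemma gdms_map_interior v w : edge v w ->
  gdms_map Phi v w @` interior (gdms_set Phi w) `<=` interior (gdms_set Phi v).
Proof.
move=> vw; apply: subset_trans (similarity_interior (ratio_gt0 v) (gdms_similarity Phi vw)) _.
exact: interiorS (gdms_maps_to vw).
Qed.

(** The composition along the edges of the path with vertices [s] followed by [a]. *)
Fixpoint path_map s a : 'rV[R]_D -> 'rV[R]_D :=
  if s is v :: s' then gdms_map Phi v (head a s') \o path_map s' a else id.

Lemma path_map_cat s t a :
  path_map (s ++ t) a = path_map s (head a t) \o path_map t a.
Proof. by elim: s => //= v s ->; rewrite -compA; case: s. Qed.

Lemma sorted_rcons_cons v s a : sorted (@edge d) (rcons (v :: s) a) =
  edge v (head a s) && sorted (@edge d) (rcons s a).
Proof. by case: s. Qed.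

Lemma path_map_sim s a : sorted (@edge d) (rcons s a) ->
  similarity (weight s) (path_map s a).
Proof.
elim: s => [_|v s IH] /=; first by rewrite big_nil; exact: similarity_id.
rewrite -[path _ _ _]/(sorted _ (rcons (v :: s) a)) sorted_rcons_cons => /andP[vs /IH].
by rewrite big_cons; apply: similarity_comp; exact: gdms_similarity.
Qed.

Lemma path_map_interior s a : sorted (@edge d) (rcons s a) ->
  path_map s a @` interior (gdms_set Phi a) `<=` interior (gdms_set Phi (head a s)).
Proof.
elim: s => [_|v s IH] /=; first by move=> _ [x ? <-].
rewrite -[path _ _ _]/(sorted _ (rcons (v :: s) a)) sorted_rcons_cons => /andP[vs /IH sub].
move=> _ [x xa <-]; apply: (gdms_map_interior vs); exists (path_map s a x) => //.
by apply: sub; exists x.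
Qed.

Lemma path_map_maps_to s a : sorted (@edge d) (rcons s a) ->
  path_map s a @` gdms_set Phi a `<=` gdms_set Phi (head a s).
Proof.
elim: s => [_|v s IH] /=; first by move=> _ [x ? <-].
rewrite -[path _ _ _]/(sorted _ (rcons (v :: s) a)) sorted_rcons_cons => /andP[vs /IH sub].
move=> _ [x xa <-]; apply: (gdms_maps_to vs); exists (path_map s a x) => //.
by apply: sub; exists x.
Qed.

(** Strip the common edges, whose maps are injective; the first different edges
    have disjoint images by the open set condition.  Words of different lengths
    could be comparable, whence the equality of sizes. *)
Lemma path_map_disjoint s t a :
    sorted (@edge d) (rcons s a) -> sorted (@edge d) (rcons t a) ->
    size s = size t -> s <> t ->
  (path_map s a @` interior (gdms_set Phi a)) `&`
  (path_map t a @` interior (gdms_set Phi a)) = set0.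
Proof.
elim: s t => [|v s IH] [|w t] //= sv tw [st] neq.
move: sv tw; rewrite -![path _ _ _]/(sorted _ (rcons (_ :: _) a)) !sorted_rcons_cons.
move=> /andP[vs ss] /andP[wt tt].
have [e|e] := pselect ((v, head a s) = (w, head a t)); last first.
  apply/seteqP; split => // _ [[x xa <-] [y ya yx]].
  rewrite -(gdms_osc Phi vs wt e); split.
    by exists (path_map s a x) => //; apply: path_map_interior ss _ _; exists x.
  by rewrite -yx; exists (path_map t a y) => //; apply: path_map_interior tt _ _; exists y.
case: e vs => vw hst vs; subst w.
have st' : s <> t by move=> st'; apply: neq; rewrite st'.
apply/seteqP; split => // _ [[x xa <-] [y ya]]; rewrite /= -hst.
move/(similarity_inj (ratio_gt0 v) (gdms_similarity Phi vs)) => yx.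
have : set0 (path_map s a x); last by [].
by rewrite -(IH t ss tt st st'); split; [exists x | rewrite -yx; exists y].
Qed.

Local Notation letters om := (fun i => (om i).1).

Lemma coding_edge om i : coding_space om -> edge (om i).1 (om i.+1).1.
Proof. by move=> /(_ i)[+ <-]. Qed.

Lemma coding_sorted om n : coding_space om -> sorted (@edge d) (mkseq (letters om) n).
Proof.
move=> omP; case: n => // n; apply/(sortedP (om 0%N).1) => i.
by rewrite size_mkseq => lt_in; rewrite !nth_mkseq //; [exact: coding_edge | exact: ltnW].
Qed.

Lemma map_prefixE om n : coding_space om ->
  map_prefix Phi om n = path_map (mkseq (letters om) n) (om n).1.
Proof.
move=> omP; elim: n => [//|n IH]; rewrite mkseqS -cats1 path_map_cat /= IH.
by have [_ ->] := omP n.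
Qed.

Lemma cylinderE om n : coding_space om -> cylinder Phi om n =
  path_map (mkseq (letters om) n.+1) (om n.+1).1 @` gdms_set Phi (om n.+1).1.
Proof. by move=> omP; rewrite /cylinder map_prefixE //; have [_ ->] := omP n. Qed.

Lemma cylinder_decreasing om n : coding_space om ->
  cylinder Phi om n.+1 `<=` cylinder Phi om n.
Proof.
move=> omP; rewrite !cylinderE // => _ [x xa <-].
rewrite [mkseq _ n.+2]mkseqS -cats1 path_map_cat /=.
exists (gdms_map Phi (om n.+1).1 (om n.+2).1 x) => //.
by apply: (gdms_maps_to (coding_edge n.+1 omP)); exists x.
Qed.

(** The nested compact cylinders have a common point, so the [get] in the
    definition of [coding_map] returns a point of their intersection. *)
Lemma coding_map_cylinder om n : coding_space om ->
  cylinder Phi om n (coding_map Phi om).2.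
Proof.
move=> omP; suff : (\bigcap_n cylinder Phi om n) (coding_map Phi om).2 by apply.
suff [x xP] : \bigcap_n cylinder Phi om n !=set0 by exact: getI xP.
apply: nested_compact_bigcap => [k|k|k].
- rewrite cylinderE //; apply: continuous_compact; last exact: gdms_compact.
  apply: continuous_subspaceT; apply: (similarity_continuous (word_ratio_gt0 _)).
  by apply: path_map_sim; rewrite -mkseqS; exact: coding_sorted.
- by have [x xa] := gdms_nonempty Phi (om k).2; exists (map_prefix Phi om k.+1 x), x.
- exact: cylinder_decreasing.
Qed.

Lemma word_prefixE om n : coding_space om ->
  word (word_prefix om n) = mkseq (letters om) n.
Proof.
move=> omP; rewrite -[RHS]/(word (FreeGroup (coding_sorted n omP))); congr word.
rewrite -[RHS]prod_of_letter /= /word_prefix big_map -[RHS]/(\prod_(i <- iota 0 n) _)%g.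
by rewrite -(big_mkord xpredT (fun i => of_letter (om i).1)) /index_iota subn0.
Qed.

End GDMS.

(** * Free concatenation of words of a subgroup *)

Section WordSubsystem.
Context {R : realType} {d D : nat}.
Variables (Phi : linear_gdms R d D) (N : set (free_group d)).
Hypothesis N_group : subgroup N.
Context {I : finType}.
Variables (wd : I -> seq (letter d)) (a : letter d) (m : nat).
Hypothesis m_gt0 : (0 < m)%N.
Hypothesis wd_size : forall i, size (wd i) = m.
Hypothesis wd_inj : injective wd.
Hypothesis wd_head : forall i, head a (wd i) = a.
Hypothesis wd_reduced : forall i, sorted (@edge d) (rcons (wd i) a).
Hypothesis wd_N : forall i, N (\prod_(v <- wd i) of_letter v)%g.
Implicit Types om : nat -> I.

Definition concat_letter om j : letter d := nth a (wd (om (j %/ m)%N)) (j %% m)%N.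

Definition concat_code om j : letter d * letter d :=
  (concat_letter om j, concat_letter om j.+1).

(** A prefix of an infinite concatenation is a product of full words followed by a
    prefix of one word. *)
Lemma concat_letterE om n k : (k <= m)%N ->
  mkseq (concat_letter om) (n * m + k) =
  flatten [seq wd i | i <- mkseq om n] ++ take k (wd (om n)).
Proof.
have step n' k' : (k' <= m)%N -> mkseq (concat_letter om) (n' * m + k') =
    mkseq (concat_letter om) (n' * m) ++ take k' (wd (om n')).
  move=> k'm; apply: (@eq_from_nth _ a) => [|j].
    by rewrite size_cat !size_mkseq size_takel // wd_size.
  rewrite size_mkseq => jlt; rewrite nth_mkseq // nth_cat size_mkseq.
  case: ltnP => [jn|nj]; first by rewrite nth_mkseq.
  have jk : (j - n' * m < k')%N by rewrite ltn_subLR.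
  have jm := leq_trans jk k'm.
  rewrite nth_take // /concat_letter -{1 2}(subnKC nj) divnMDl // modnMDl.
  by rewrite divn_small // modn_small // addn0.
move=> km; rewrite step //; congr cat.
elim: n {k km} => [//|n IH].
rewrite mulSn addnC step // IH mkseqS map_rcons flatten_rcons.
by rewrite -[in take _ _](wd_size (om n)) take_size.
Qed.

Lemma head_flatten t : head a (flatten [seq wd i | i <- t]) = a.
Proof.
case: t => //= i t; have := wd_head i; case E : (wd i) => //=.
by have := wd_size i; rewrite E => m0; move: m_gt0; rewrite -m0.
Qed.

Lemma flatten_reduced t : sorted (@edge d) (rcons (flatten [seq wd i | i <- t]) a).
Proof.
elim: t => //= i t IH; rewrite rcons_cat.
have : head a (rcons (flatten [seq wd i | i <- t]) a) = a.
  by rewrite headI /= head_flatten.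
move: IH; rewrite headI /= => bu hb; rewrite hb in bu *.
by rewrite sorted_cat_cons wd_reduced.
Qed.

Lemma concat_edge om j : edge (concat_letter om j) (concat_letter om j.+1).
Proof.
have : sorted (@edge d) (mkseq (concat_letter om) (j.+2 * m + 0)).
  rewrite concat_letterE // take0 cats0.
  by have := flatten_reduced (mkseq om j.+2); rewrite -cats1 => /cat_sorted2[].
rewrite addn0 => /(sortedP a)/(_ j); rewrite size_mkseq.
have lt_j : (j.+1 < j.+2 * m)%N by rewrite leq_pmulr.
by rewrite !nth_mkseq ?(ltnW lt_j) // => /(_ lt_j).
Qed.

Lemma concat_coding om : coding_space (concat_code om).
Proof. by move=> i; split => //; exact: concat_edge. Qed.

Lemma concat_start om n : concat_letter om (n * m) = a.
Proof.
by rewrite /concat_letter mulnK // modnMl -(wd_head (om n)) nth0; case: (wd (om n)).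
Qed.

Lemma concat_word_map om n :
  path_map Phi (mkseq (concat_letter om) (n * m)) a =
  word_map (fun i => path_map Phi (wd i) a) (mkseq om n).
Proof.
rewrite -[(n * m)%N]addn0 concat_letterE // take0 cats0.
by elim: (mkseq om n) => //= i t <-; rewrite path_map_cat head_flatten.
Qed.

(** The point coded by the concatenation lies in all cylinders of the iterated
    function system formed by the maps of the words. *)
Lemma concat_cylinder om n :
  (word_map (fun i => path_map Phi (wd i) a) (mkseq om n) @` gdms_set Phi a)
    (coding_map Phi (concat_code om)).2.
Proof.
rewrite -concat_word_map; case: (posnP n) => [->|n0].
  have := coding_map_cylinder Phi 0 (concat_coding om).
  rewrite cylinderE; last exact: concat_coding.
  move=> /path_map_maps_to /=.
  rewrite -[concat_letter om 0](_ : concat_letter om (0 * m) = _) // concat_start => q0.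
  exists (coding_map Phi (concat_code om)).2 => //; apply: q0.
  by rewrite andbT -[X in edge X _](concat_start om 0); exact: concat_edge.
have nm : (n * m).-1.+1 = (n * m)%N by rewrite prednK // muln_gt0 n0.
have := coding_map_cylinder Phi (n * m).-1 (concat_coding om).
rewrite cylinderE; last exact: concat_coding.
by rewrite nm /= concat_start.
Qed.

(** The finite set of proper prefixes of the words serves as Gamma. *)
Lemma concat_uniformly_radial om :
  uniformly_radial_limit_set Phi N (coding_map Phi (concat_code om)).
Proof.
exists (concat_code om) => //; split; first exact: concat_coding.
exists (range (fun ik : I * 'I_m => \prod_(v <- take ik.2 (wd ik.1)) of_letter v)%g).
split; first by apply: finite_image; exact: finite_finset.
move=> n; pose l := (n.+1 %/ m)%N; pose k := (n.+1 %% m)%N.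
have km : (k < m)%N by rewrite ltn_pmod.
exists (\prod_(i <- mkseq om l) \prod_(v <- wd i) of_letter v)%g.
exists (\prod_(v <- take k (wd (om l))) of_letter v)%g; split.
- have [N1 NM _] := N_group.
  by elim: (mkseq om l) => [|i t IH]; rewrite ?big_nil // big_cons; exact: NM.
- by exists (om l, Ordinal km).
- rewrite -[LHS]prod_of_letter word_prefixE; last exact: concat_coding.
  rewrite -[mkseq _ _](_ : mkseq (concat_letter om) (l * m + k) = _); last by rewrite -divn_eq.
  by rewrite concat_letterE 1?ltnW // big_cat big_flatten big_map.
Qed.

Lemma union_edist_refl (p : letter d * 'rV[R]_D) : union_edist p p = 0%E.
Proof. by rewrite /union_edist eqxx edist_refl. Qed.

Theorem subsystem_lower_bound (s : R) : 0 <= s ->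
  1 <= \sum_i (\prod_(v <- wd i) gdms_ratio Phi v) `^ s ->
  hausdorff_measure (@union_edist R d D) s (uniformly_radial_limit_set Phi N) <> 0%E.
Proof.
move=> s0 sum_ge1.
have [cmin [cmax [cmin0 cmax01 cP]]] := ratio_bounds Phi.
have [Delta _ DeltaP] := gdms_diameter_bound Phi.
(* X_a is the closure of its interior, so the interior is not empty. *)
have [z0 z0O] : interior (gdms_set Phi a) !=set0.
  apply: contrapT => /set0P/negP; rewrite negbK => /eqP O0.
  have [x] := gdms_nonempty Phi a; rewrite (gdms_regular Phi a) O0 closure0.
  by [].
have /nbhs_edistP[eta eta0 ball_O] : nbhs z0 (interior (gdms_set Phi a)).
  by apply: nbhs_interior.
have rP i : cmin ^+ m <= \prod_(v <- wd i) gdms_ratio Phi v <= cmax.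
  have /andP[lo hi] := cP (wd i); rewrite wd_size in lo hi; rewrite lo (le_trans hi) //.
  have /andP[c0 c1] := cmax01; rewrite -(prednK m_gt0) exprS ler_piMr //.
  by rewrite exprn_ile1 // ltW.
have cm0 : 0 < cmin ^+ m by rewrite exprn_gt0.
have cmax1 : cmax < 1 by have /andP[] := cmax01.
have f_sim i : similarity (\prod_(v <- wd i) gdms_ratio Phi v) (path_map Phi (wd i) a).
  exact: path_map_sim.
have f_O i : path_map Phi (wd i) a @` interior (gdms_set Phi a) `<=` interior (gdms_set Phi a).
  by rewrite -[X in _ `<=` interior (gdms_set Phi X)](wd_head i); exact: path_map_interior.
have f_disj i j : i != j ->
    (path_map Phi (wd i) a @` interior (gdms_set Phi a)) `&`
    (path_map Phi (wd j) a @` interior (gdms_set Phi a)) = set0.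
  move=> ij; apply: path_map_disjoint => //; first by rewrite !wd_size.
  by move/wd_inj/eqP; rewrite (negbTE ij).
have dist_q om om' :
    ((edist (coding_map Phi (concat_code om)).2 (coding_map Phi (concat_code om')).2)%:E <=
     union_edist (coding_map Phi (concat_code om)) (coding_map Phi (concat_code om')))%E.
  by rewrite /union_edist; case: ifP => // _; rewrite leey.
have sub : range (fun om => coding_map Phi (concat_code om)) `<=`
    uniformly_radial_limit_set Phi N.
  by move=> _ [om _ <-]; exact: concat_uniformly_radial.
exact: (moran_lower_bound f_sim cm0 cmax1 rP eta0 ball_O f_O f_disj (@DeltaP a)
  (@interior_subset _ _) dist_q concat_cylinder union_edist_refl s0 sum_ge1 sub).
Qed.

End WordSubsystem.

(** * Words in a normal subgroup *)

Section WordSelection.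
Context {R : realType} {d D : nat}.
Hypothesis d_ge2 : (2 <= d)%N.
Variables (Phi : linear_gdms R d D) (N : set (free_group d)).
Hypothesis N_normal : normal_subgroup N.
Implicit Types (a b : letter d) (x k : free_group d).

(** There are 2 d >= 4 letters. *)
Lemma fresh_letter (l : seq (letter d)) : (size l < 4)%N -> exists v, v \notin l.
Proof.
move=> l4; apply: contrapT => /forallNP all_in.
have : (#|{: letter d}| <= size l)%N.
  rewrite -(eq_card (_ : mem l =i predT)) ?card_size // => v.
  by rewrite inE; apply/negPn/negP/all_in.
by rewrite card_prod card_ord card_bool; lia.
Qed.

(** Conjugate the nontrivial element [k0] by the two letters u1 u2: u2 is chosen so
    that u2 k0 u2^-1 is reduced, and u1 so that nothing cancels with [b], [a] and
    u2.  One letter could not do both, since for d = 2 there may be four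
    forbidden letters. *)
Lemma connecting_word k0 a b : N k0 -> k0 <> 1%g ->
  exists2 k, N k & path (@edge d) b (rcons (word k) a).
Proof.
move=> Nk0 k0_neq1; case E : (word k0) => [|x p].
  by case: k0_neq1; apply: val_inj; rewrite /= E.
have [u2] := @fresh_letter [:: inv_letter x; last x p] isT.
rewrite !inE negb_or => /andP[u2x u2y].
have [u1] := @fresh_letter [:: inv_letter b; a; inv_letter u2] isT.
rewrite !inE !negb_or => /and3P[u1b u1a u1u2].
pose s := [:: u1, u2, x & p ++ [:: inv_letter u2; inv_letter u1]].
have ps : path (@edge d) b (rcons s a).
  have := word_reduced k0; rewrite E /= rcons_cat cat_path => ->.
  rewrite /= /edge !inv_letterK u1u2 u2x [last x p == _]eq_sym u2y.
  rewrite [inv_letter u2 == _]eq_sym u1u2 (inj_eq (inv_inj (@inv_letterK d))) u1a !andbT.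
  by rewrite -(inj_eq (inv_inj (@inv_letterK d))) inv_letterK eq_sym u1b.
have rs : sorted (@edge d) s.
  by move: ps; rewrite rcons_path => /andP[/path_sorted].
exists (FreeGroup rs) => //.
pose g := (of_letter (inv_letter u2) * of_letter (inv_letter u1))%g.
have := N_normal.2 _ g Nk0; congr N.
rewrite -[RHS]prod_of_letter /= /s !big_cons big_cat !big_cons big_nil.
rewrite -[k0 in LHS]prod_of_letter E big_cons /g invgM -!of_letterV !inv_letterK.
by rewrite /= mulg1 !mulgA.
Qed.

(** Were the sum larger, the words x k, x in [l], would have an s-sum of at least 1
    and generate a subsystem whose limit set, contained in Lambda_ur, has positive
    s-dimensional measure. *)
Lemma class_sum_bound (l : seq (free_group d)) k a b n (s : R) :
    0 <= s -> hausdorff_measure (@union_edist R d D) s (uniformly_radial_limit_set Phi N) = 0%E ->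
    (0 < n)%N -> uniq l ->
    (forall x, x \in l -> [/\ N x, size (word x) = n, head a (word x) = a & last a (word x) = b]) ->
    N k -> path (@edge d) b (rcons (word k) a) ->
  \sum_(x <- l) fg_ratio Phi x `^ s <= (fg_ratio Phi k `^ s)^-1.
Proof.
move=> s0 null n0 ul lP Nk kab; rewrite leNgt; apply/negP => big_sum.
have k_gt0 := word_ratio_gt0 Phi (word k); have ks_gt0 := powR_gt0 s k_gt0.
pose wd (i : 'I_(size l)) := word (nth 1%g l i) ++ word k.
have nth_l (i : 'I_(size l)) : nth 1%g l i \in l by rewrite mem_nth.
have wd_size i : size (wd i) = (n + size (word k))%N.
  by rewrite size_cat; have [_ -> _ _] := lP _ (nth_l i).
have wd_inj : injective wd.
  move=> i j /eqP; rewrite /wd eqseq_cat; last first.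
    by have [_ -> _ _] := lP _ (nth_l i); have [_ -> _ _] := lP _ (nth_l j).
  move=> /andP[/eqP/val_inj/eqP]; rewrite nth_uniq // => /eqP ij _.
  exact: val_inj.
have wd_head i : head a (wd i) = a.
  have [_ sx hx _] := lP _ (nth_l i); rewrite /wd; case: (word _) sx hx => //= sx.
  by move: n0; rewrite -sx.
have wd_red i : sorted (@edge d) (rcons (wd i) a).
  have [_ sx _ lx] := lP _ (nth_l i); rewrite /wd rcons_cat.
  move: (word_reduced (nth 1%g l i)) sx lx; case: (word _) => [_ sx|c u /= cu _ lx].
    by move: n0; rewrite -sx.
  by rewrite cat_path cu lx.
have wd_N i : N (\prod_(v <- wd i) of_letter v)%g.
  have [Nx _ _ _] := lP _ (nth_l i); have [_ NM _] := N_normal.1.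
  by rewrite big_cat !prod_of_letter; exact: NM.
have m0 : (0 < n + size (word k))%N by rewrite addn_gt0 n0.
apply: (@subsystem_lower_bound R d D Phi N N_normal.1 _ wd a _ m0 wd_size wd_inj
  wd_head wd_red wd_N s s0 _ null).
have -> : \sum_i (\prod_(v <- wd i) gdms_ratio Phi v) `^ s =
    (\sum_(x <- l) fg_ratio Phi x `^ s) * fg_ratio Phi k `^ s.
  rewrite mulr_suml (big_nth 1%g) big_mkord; apply: eq_bigr => i _.
  by rewrite big_cat /= powRM ?(ltW (word_ratio_gt0 Phi _)).
by rewrite -ler_pdivrMr // div1r ltW.
Qed.

(** In the class of length n and end letters (a, b) the t-sum is at most rho^n times
    the s-sum, with rho = cmax^(t - s) < 1; the bounds on the s-sums make the total
    a geometric series. *)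
Theorem divergence_lower_bound (s t : R) : 0 <= s -> s < t ->
    hausdorff_measure (@union_edist R d D) s (uniformly_radial_limit_set Phi N) = 0%E ->
  (\esum_(h in N) (fg_ratio Phi h `^ t)%:E < +oo)%E.
Proof.
move=> s0 st null.
have ratio_ge0 h : (0 <= (fg_ratio Phi h `^ t)%:E)%E by rewrite lee_fin powR_ge0.
(* The identity has no first letter and is set apart. *)
rewrite (esumID [set 1%g]) //; apply: lte_add_pinfty.
  apply: (@le_lt_trans _ _ (\esum_(h in [set 1%g]) (fg_ratio Phi h `^ t)%:E)%E).
    rewrite [leLHS]esum_mkcond [leRHS]esum_mkcond; apply: le_esum => h _.
    by case: ifPn => [/set_mem[_ h1]|_]; [rewrite mem_set | case: ifP].
  by rewrite esum_set1 ?ltry.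
have [[k0 [Nk0 k0_neq1]]|triv] := pselect (exists k0, N k0 /\ k0 <> 1%g); last first.
  by rewrite esum1 ?ltry // => h [Nh h1]; case: triv; exists h.
have /choice[kk kkP] : forall ab : letter d * letter d,
    exists k, N k /\ path (@edge d) ab.2 (rcons (word k) ab.1).
  by move=> [a b]; have [k] := connecting_word a b Nk0 k0_neq1; exists k.
have [cmin [cmax [_ /andP[c0 c1] cP]]] := ratio_bounds Phi.
have [a0 _] := @fresh_letter [::] isT.
pose rho := cmax `^ (t - s).
have rho0 : 0 <= rho by exact: powR_ge0.
have rho1 : rho < 1.
  have <- : 1 `^ (t - s) = 1 :> R by rewrite powR1.
  by apply: gt0_ltr_powR; rewrite ?subr_gt0 ?nnegrE.
pose C ab := (fg_ratio Phi (kk ab) `^ s)^-1.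
have C0 ab : 0 <= C ab by rewrite invr_ge0 powR_ge0.
apply: (@le_lt_trans _ _ ((1 - rho)^-1 * \sum_ab C ab)%:E); last exact: ltry.
apply: ge_ereal_sup => _ [F [finF FN] <-].
rewrite fsbig_finite // sumEFin lee_fin; set l := (X in \sum_(i <- X) _).
have ul : uniq l by exact: finmap.fset_uniq.
have lP x : x \in l -> N x /\ x <> 1%g by rewrite in_fset_set // => /set_mem/FN.
pose K := \max_(x <- l) size (word x).
pose cls x : 'I_K.+1 * (letter d * letter d) :=
  (inord (size (word x)), (head a0 (word x), last a0 (word x))).
rewrite (partition_big cls xpredT) //=.
apply: (@le_trans _ _ (\sum_(c : 'I_K.+1 * (letter d * letter d)) rho ^+ c.1 * C c.2)).
  apply: ler_sum => -[n [a b]] _ /=; rewrite -big_filter.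
  set lc := [seq x <- l | _].
  have lcP x : x \in lc -> [/\ N x, x <> 1%g, size (word x) = n,
      head a0 (word x) = a & last a0 (word x) = b].
    rewrite mem_filter => /andP[/eqP[nE <- <-] xl]; have [Nx x1] := lP x xl.
    split => //; rewrite -nE inordK // ltnS.
    exact: (@leq_bigmax_seq _ _ xpredT (fun x => size (word x))).
  case E : lc => [|x0 lc'].
    by rewrite big_nil mulr_ge0 ?exprn_ge0.
  rewrite -E; have x0l : x0 \in lc by rewrite E mem_head.
  have n0 : (0 < n)%N.
    have [_ x01 <- _ _] := lcP x0 x0l; case Ew : (word x0) => //.
    by case: x01; apply: val_inj; rewrite /= Ew.
  apply: (@le_trans _ _ (rho ^+ n * \sum_(x <- lc) fg_ratio Phi x `^ s)).
    rewrite mulr_sumr big_seq [leRHS]big_seq; apply: ler_sum => x /lcP[_ _ sx _ _].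
    have x_gt0 := word_ratio_gt0 Phi (word x).
    rewrite -[t](subrK s) powRD; last by rewrite (gt_eqF x_gt0) implybT.
    rewrite ler_wpM2r ?powR_ge0 // /rho -powR_mulrn ?powR_ge0 // -powRrM mulrC powRrM.
    rewrite powR_mulrn //; apply: ge0_ler_powR.
    - by rewrite subr_ge0 ltW.
    - by rewrite nnegrE ltW.
    - by rewrite nnegrE exprn_ge0.
    - by have /andP[_] := cP (word x); rewrite sx.
  rewrite ler_wpM2l ?exprn_ge0 //; have [Nk kab] := kkP (a, b).
  apply: (@class_sum_bound lc _ a b n) => //; first exact: filter_uniq.
  move=> x /lcP[Nx _ sx hx lx]; split => //.
    by move: sx hx; case: (word x) => [sx|//]; move: n0; rewrite -sx.
  by move: sx lx; case: (word x) => [sx|//]; move: n0; rewrite -sx.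
rewrite -(pair_bigA _ (fun (i : 'I_K.+1) ab => rho ^+ i * C ab)) /=.
under eq_bigr do rewrite -mulr_sumr.
rewrite -mulr_suml ler_wpM2r ?sumr_ge0 //.
rewrite -[leRHS]mul1r ler_pdivlMr ?subr_gt0 //.
by rewrite mulrC -opprB mulNr -subrX1 opprB lerBlDr lerDl exprn_ge0.
Qed.

End WordSelection.

(** * Covering the radial limit set *)

HB.instance Definition _ d := [Countable of free_group d by <:].

Section UpperBound.
Context {R : realType} {d D : nat}.
Variables (Phi : linear_gdms R d D) (N : set (free_group d)).
Implicit Types (g h x y : free_group d) (om : nat -> letter d * letter d).

Local Notation ratio := (fg_ratio Phi).

Lemma fg_ratio_gt0 x : 0 < ratio x.
Proof. exact: word_ratio_gt0. Qed.

(** Each cancellation removes two factors smaller than 1. *)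
Lemma fg_ratio_supermul x y : ratio x * ratio y <= ratio (x * y)%g.
Proof.
case: x y => [u ru] [v rv]; rewrite /fg_ratio /=.
elim: u {ru} => [|c u IH] /=; first by rewrite big_nil mul1r.
rewrite big_cons -mulrA; apply: (@le_trans _ _ (gdms_ratio Phi c *
    \prod_(w <- mul_word u v) gdms_ratio Phi w)).
  by rewrite ler_pM2l // ratio_gt0.
case: (mul_word u v) => [|e w] /=; first by rewrite !big_cons.
case: ifP => _; first by rewrite !big_cons.
rewrite big_cons mulrA ler_piMl ?(ltW (word_ratio_gt0 Phi w)) //.
have /andP[c0 c1] := gdms_ratio_itv Phi c; have /andP[e0 e1] := gdms_ratio_itv Phi e.
by rewrite mulr_ile1 // ltW.
Qed.

Lemma fg_ratio_mulr h g : ratio (h * g)%g <= (ratio g^-1%g)^-1 * ratio h.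
Proof.
rewrite mulrC ler_pdivlMr ?fg_ratio_gt0 //; apply: le_trans (fg_ratio_supermul _ _) _.
by rewrite -mulgA mulgV mulg1.
Qed.

(** The next edge is not prescribed, so that cells are indexed by group elements. *)
Definition prefix_cell g : set (letter d * 'rV[R]_D) :=
  coding_map Phi @` [set om | coding_space om /\ exists n, word_prefix om n.+1 = g].

(** The last letter of [g] determines only the set [X_v] in which the remaining
    point lies, so one factor [c(v)] is lost in the diameter; it is absorbed in M. *)
Lemma ediam_prefix_cell : exists2 M : R, 0 < M & forall g,
  (ediam (@union_edist R d D) (prefix_cell g) <= (M * ratio g)%:E)%E.
Proof.
have [cmin [cmax [cmin0 _ cP]]] := ratio_bounds Phi.
have [Delta Delta0 DeltaP] := gdms_diameter_bound Phi.
exists ((Delta + 1) / cmin) => [|g]; first by rewrite divr_gt0 // ltr_wpDl.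
have cellE om n : coding_space om -> word_prefix om n.+1 = g -> exists u v,
    [/\ word g = rcons u v, (om 0%N).1 = head v u, sorted (@edge d) (rcons u v) &
    exists2 x, gdms_set Phi v x & path_map Phi u v x = (coding_map Phi om).2].
  move=> omP omg; have := coding_map_cylinder Phi n omP; rewrite cylinderE //.
  have := word_prefixE n.+1 omP; rewrite omg mkseqS => gE [x xn].
  rewrite -cats1 path_map_cat /= => <-.
  exists (mkseq (fun i => (om i).1) n), (om n).1; split => //; first by case: (n).
    by rewrite -mkseqS; exact: coding_sorted.
  exists (gdms_map Phi (om n).1 (om n.+1).1 x) => //.
  by apply: (gdms_maps_to (coding_edge n omP)); exists x.
apply: ge_ereal_sup => _ [_ [om [omP [n omg]] <-] [_ [om' [om'P [n' om'g]] <-] <-]].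
have [u [v [gE hE sE [x vx xE]]]] := cellE _ _ omP omg.
have [u' [v' [gE' hE' _ [x' vx' xE']]]] := cellE _ _ om'P om'g.
have /rcons_inj[uu vv] : rcons u v = rcons u' v' by rewrite -gE.
subst u' v'; rewrite /union_edist /= hE hE' eqxx lee_fin -[leLHS]/(edist _ _).
have := xE; have := xE'; rewrite /coding_map /= => <- <-.
rewrite (path_map_sim Phi sE).
have -> : ratio g = \prod_(w <- u) gdms_ratio Phi w * gdms_ratio Phi v.
  by rewrite /fg_ratio gE -cats1 big_cat big_seq1.
have u_gt0 := word_ratio_gt0 Phi u.
rewrite mulrCA ler_pM2l // mulrAC ler_pdivlMr //.
have /andP[cv _] := cP [:: v]; rewrite big_seq1 /= expr1 in cv.
have Dx := DeltaP v x x' vx vx'.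
apply: (@le_trans _ _ ((Delta + 1) * cmin)); last by rewrite ler_wpM2l // addr_ge0.
by rewrite ler_wpM2r ?(ltW cmin0) // (le_trans Dx) // lerDl.
Qed.

(** The cover is indexed by pairs (g, h) with h in N outside a finite set F(g), and
    consists of the cells of h g.  F(g) is chosen so large that the g-th part costs
    at most eps(g), and the eps(g) sum up to at most e.  The finite set is harmless
    since distinct prefixes of a code are distinct elements. *)
Theorem radial_null (t : R) : 0 <= t ->
    (\esum_(h in N) (ratio h `^ t)%:E < +oo)%E ->
  hausdorff_measure (@union_edist R d D) t (radial_limit_set Phi N) = 0%E.
Proof.
move=> t0 sum_fin; apply/eqP; rewrite eq_le hausdorff_measure_ge0 andbT.
apply: ge_ereal_sup => _ [delta delta0 <-]; apply/lee_addgt0Pr => e e0; rewrite add0e.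
have [M M0 cellM] := ediam_prefix_cell.
have [cmin [cmax [_ /andP[c0 c1] cP]]] := ratio_bounds Phi.
have ratio_ge0 h : (0 <= (ratio h `^ t)%:E)%E by rewrite lee_fin powR_ge0.
pose K g := (M * (ratio g^-1%g)^-1) `^ t.
have K0 g : 0 < K g by rewrite powR_gt0 // mulr_gt0 // invr_gt0 fg_ratio_gt0.
pose eps g := e / (2 ^ (pickle g).+1)%:R.
have eps0 g : 0 < eps g by rewrite divr_gt0 // ltr0n expn_gt0.
have /choice[F FP] : forall g, exists F : set (free_group d), finite_set F /\
    (\esum_(h in N `&` ~` F) (ratio h `^ t)%:E <= (eps g / K g)%:E)%E.
  move=> g; have [|F finF FN] := @esum_tail _ _ N _ (eps g / K g) ratio_ge0 _ sum_fin.
    by rewrite divr_gt0.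
  by exists F.
pose J g := [set h | [/\ N h, ~ F g h & M * ratio (h * g)%g <= delta]].
pose U gh := prefix_cell (gh.2 * gh.1)%g.
apply: (@le_trans _ _ (\esum_(gh in [set: free_group d] `*`` J)
    diam_power (@union_edist R d D) t (U gh))%E).
  apply: hausdorff_premeasure_le_esum => [|[g h] [_ [_ _ hg]]]; last first.
    by apply: le_trans (cellM _) _; rewrite lee_fin.
  move=> _ [om [omP [g inf]] <-].
  pose bad := [set n | F g (word_prefix om n.+1 * g^-1)%g].
  have bad_fin : finite_set bad.
    apply: finite_preimage (FP g).1 => n n' _ _ /mulIg => /(congr1 (size \o @word d)).
    by rewrite /= !word_prefixE // !size_mkseq => -[].
  have [L LP] : exists L, forall n, (L <= n)%N -> M * cmax ^+ n.+1 <= delta.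
    have := @cvg_expr R cmax; rewrite ger0_norm // => /(_ c1) /cvgr0Pnorm_lt.
    move=> /(_ _ (divr_gt0 delta0 M0)) [L _ LP]; exists L => n Ln.
    rewrite mulrC -ler_pdivlMr //; apply: le_trans (ler_norm _) (ltW (LP _ _)).
    by rewrite /= leqW.
  have [n [[h Nh nE] nbad Ln]] : exists n, [/\ exists2 h, N h &
      word_prefix om n.+1 = (h * g)%g, ~ bad n & (L <= n)%N].
    apply: contrapT => /forallNP none; apply: inf.
    apply: (@sub_finite_set _ _ (bad `|` `I_L)).
      move=> n nP; have [Ln|nL] := leqP L n; last by right.
      by left; apply: contrapT => nb; apply: (none n).
    by rewrite finite_setU; split => //; exact: finite_II.
  have hE : h = (word_prefix om n.+1 * g^-1)%g by rewrite nE mulgK.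
  exists (g, h); last by exists om => //; split => //; exists n.
  split => //; split => //; first by rewrite /= hE.
  rewrite -nE; apply: le_trans (LP n Ln); rewrite ler_pM2l //.
  have /andP[_] := cP (word (word_prefix om n.+1)).
  by rewrite [size _](_ : _ = n.+1) // word_prefixE // size_mkseq.
rewrite -(@esum_esum _ _ _ _ _
  (fun g h => diam_power (@union_edist R d D) t (U (g, h)))); last first.
  by move=> *; exact: diam_power_ge0.
apply: (@le_trans _ _ (\esum_(g in [set: free_group d]) (eps g)%:E)%E).
  apply: le_esum => g _.
  apply: (@le_trans _ _ (\esum_(h in N `&` ~` F g) ((K g)%:E * (ratio h `^ t)%:E))%E).
    apply: (@le_trans _ _ (\esum_(h in J g) ((K g)%:E * (ratio h `^ t)%:E))%E); last first.
      apply: le_esum_subset => [h _|h [? ? _] //].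
      by rewrite mule_ge0 // lee_fin ltW.
    apply: le_esum => h _; rewrite /diam_power; case: asboolP => [_|/eqP/set0P U0].
      by rewrite mule_ge0 // lee_fin ltW.
    have U_ge0 := ediam_ge0 (@union_edist_refl R d D) U0.
    have MK_gt0 : 0 < M / ratio g^-1%g by rewrite divr_gt0 // fg_ratio_gt0.
    rewrite -EFinM -powRM ?(ltW (fg_ratio_gt0 _)) ?(ltW MK_gt0) //.
    rewrite -poweR_EFin.
    apply: gt0_ler_poweR => //.
    - by rewrite in_itv /= U_ge0 leey.
    - by rewrite in_itv /= leey andbT lee_fin ltW // mulr_gt0 // fg_ratio_gt0.
    - apply: le_trans (cellM _) _; rewrite lee_fin -mulrA ler_pM2l //.
      exact: fg_ratio_mulr.
  apply: le_trans (esumZl_le _ (ltW (K0 g)) ratio_ge0) _.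
  apply: le_trans (lee_wpmul2l _ (FP g).2) _; first by rewrite lee_fin ltW.
  by rewrite -EFinM mulrC divfK // gt_eqF.
apply: le_trans (epsilon_trick0 xpredT (ltW e0)).
rewrite nneseries_esumT => [|n]; last by rewrite lee_fin divr_ge0 // ltW.
pose b n := (e / (2 ^ n.+1)%:R)%:E.
rewrite -(@esum_image R _ _ setT pickle b); last by move=> ? ? _ _; exact: (pcan_inj pickleK).
by apply: le_esum_subset => // n _; rewrite lee_fin divr_ge0 // ltW.
Qed.

Lemma uniformly_radial_sub_radial :
  uniformly_radial_limit_set Phi N `<=` radial_limit_set Phi N.
Proof.
move=> _ [om [omP [Gamma [finG GP]]] <-]; exists om => //; split => //.
apply: contrapT => /forallNP none; apply: infinite_nat.
pose hits g := [set n | exists2 h, N h & word_prefix om n.+1 = (h * g)%g].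
apply: (@sub_finite_set _ _ (\bigcup_(g in Gamma) hits g)).
  by move=> n _; have [h [g [Nh Gg nE]]] := GP n; exists g => //; exists h.
by apply: bigcup_finite => // g _; apply: contrapT; exact: none.
Qed.

End UpperBound.

(** * The dimension formula *)

Lemma critical_exponent_le_dim (R : realType) (d D : nat) (hd : (2 <= d)%N)
    (Phi : linear_gdms R d D) (N : set (free_group d)) : normal_subgroup N ->
  (critical_exponent Phi N <=
   hausdorff_dim (@union_edist R d D) (uniformly_radial_limit_set Phi N))%E.
Proof.
move=> hN; apply: le_ereal_inf_tmp => _ [s [s0 null] <-].
apply/lee_addgt0Pr => e e0; apply: ereal_inf_lbound; exists (s + e) => //.
split; first by rewrite addr_ge0 // ltW.
by apply: (divergence_lower_bound hd hN s0 _ null); rewrite ltrDl.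
Qed.

Lemma dim_radial_le_critical_exponent (R : realType) (d D : nat)
    (Phi : linear_gdms R d D) (N : set (free_group d)) :
  (hausdorff_dim (@union_edist R d D) (radial_limit_set Phi N) <=
   critical_exponent Phi N)%E.
Proof.
apply: ereal_inf_le_tmp => _ [t [t0 sum_fin] <-]; exists t => //; split => //.
exact: radial_null.
Qed.

Theorem proposition1p3 (R : realType) (d D : nat) (hd : (2 <= d)%N)
    (hD : (1 <= D)%N) (Phi : linear_gdms R d D)
    (N : set (free_group d)) (hN : normal_subgroup N) :
  critical_exponent Phi N =
    hausdorff_dim (@union_edist R d D) (uniformly_radial_limit_set Phi N) /\
  hausdorff_dim (@union_edist R d D) (uniformly_radial_limit_set Phi N) =
    hausdorff_dim (@union_edist R d D) (radial_limit_set Phi N).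
Proof.
have lower := critical_exponent_le_dim hd Phi hN.
have upper := dim_radial_le_critical_exponent Phi N.
have ur_r := hausdorff_dim_subset (@union_edist R d D)
  (@uniformly_radial_sub_radial R d D Phi N).
split; apply/eqP; rewrite eq_le.
- by rewrite lower (le_trans ur_r).
- by rewrite ur_r (le_trans upper).
Qed.
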